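(* If there exists an $\alpha$-approximation algorithm for \textsc{Graph-Coverage-MP}, then there exists a $(164-163\alpha)$-approximation algorithm for \textsc{Max-cut}.
   Context: \textsc{Graph-Coverage-MP}: given a graph $G=(V,E)$ with non-negative edge weights $w$ and distinct terminals $t_1,\dots,t_k\in V$, find a partition $S_1,\dots,S_k$ of $V$ with $t_i\in S_i$ minimizing $\sum_i b(S_i)$, where $b(S)=\sum_{e\in E:\ e\cap S\ne\emptyset}w_e$; an $\alpha$-approximation ($\alpha\ge1$) returns a feasible solution of cost at most $\alpha$ times optimum. \textsc{Max-cut}: given a graph $G=(V,E)$, find $U\subseteq V$ maximizing the number $d(U)$ of edges with exactly one endpoint in $U$; a $\beta$-approximation returns $U$ with $d(U)\ge\beta$ times the optimum. *)

(* Defs.v *)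
From Corelib Require Import PosDef.
From mathcomp Require Import all_boot all_order all_algebra.
From mathcomp Require Import reals.

Set Implicit Arguments.
Unset Strict Implicit.
Unset Printing Implicit Defensive.

Import Order.TTheory GRing.Theory Num.Theory.

(* Deterministic polynomial time, through a WHILE language over binary trees
   (N. D. Jones, "Computability and Complexity", 1997).  A program reads its
   input in variable 0, all other variables being Leaf, and leaves its output
   in variable 0.

   The cost of an expression is the total size of the values of its
   subexpressions, so the measured time is that of an implementation that
   copies trees without any sharing.  No tree larger than the time spent can
   therefore be built, and polynomial time here coincides with polynomial time
   on Turing machines. *)

Inductive tree : Type := Leaf | Node of tree & tree.

Fixpoint tsize (t : tree) : nat :=
  if t is Node l r then (tsize l + tsize r).+1 else 1.

Definition thd (t : tree) : tree := if t is Node l _ then l else Leaf.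
Definition ttl (t : tree) : tree := if t is Node _ r then r else Leaf.

Inductive expr : Type :=
  | EVar of nat
  | ELeaf
  | ECons of expr & expr
  | EHd of expr
  | ETl of expr.

Inductive cmd : Type :=
  | CSkip
  | CAssign of nat & expr
  | CSeq of cmd & cmd
  | CIf of expr & cmd & cmd
  | CWhile of expr & cmd.

Definition store : Type := nat -> tree.

Definition update (s : store) (x : nat) (v : tree) : store :=
  fun y => if y == x then v else s y.

Fixpoint eval (s : store) (e : expr) : tree :=
  match e with
  | EVar x => s x
  | ELeaf => Leaf
  | ECons e1 e2 => Node (eval s e1) (eval s e2)
  | EHd e1 => thd (eval s e1)
  | ETl e1 => ttl (eval s e1)
  end.

Fixpoint ecost (s : store) (e : expr) : nat :=
  tsize (eval s e) +
  match e with
  | EVar _ | ELeaf => 0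
  | ECons e1 e2 => ecost s e1 + ecost s e2
  | EHd e1 | ETl e1 => ecost s e1
  end.

(* Leaf is false, every Node is true. *)
Definition truthy (t : tree) : bool := if t is Node _ _ then true else false.

(* [exec c s n s']: from store s, c terminates in store s' at cost n. *)
Inductive exec : cmd -> store -> nat -> store -> Prop :=
  | XSkip s : exec CSkip s 1 s
  | XAssign s x e :
      exec (CAssign x e) s (ecost s e).+1 (update s x (eval s e))
  | XSeq c1 c2 s s1 s2 n1 n2 :
      exec c1 s n1 s1 -> exec c2 s1 n2 s2 ->
      exec (CSeq c1 c2) s (n1 + n2).+1 s2
  | XIfTrue e c1 c2 s s1 n1 :
      truthy (eval s e) -> exec c1 s n1 s1 ->
      exec (CIf e c1 c2) s (ecost s e + n1).+1 s1
  | XIfFalse e c1 c2 s s1 n1 :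
      ~~ truthy (eval s e) -> exec c2 s n1 s1 ->
      exec (CIf e c1 c2) s (ecost s e + n1).+1 s1
  | XWhileTrue e c s s1 s2 n1 n2 :
      truthy (eval s e) -> exec c s n1 s1 -> exec (CWhile e c) s1 n2 s2 ->
      exec (CWhile e c) s (ecost s e + n1 + n2).+1 s2
  | XWhileFalse e c s :
      ~~ truthy (eval s e) -> exec (CWhile e c) s (ecost s e).+1 s.

Definition init_store (v : tree) : store := fun x => if x == 0 then v else Leaf.

Definition runs_to (p : cmd) (input : tree) (time : nat) (output : tree) : Prop :=
  exists2 s : store, exec p (init_store input) time s & s 0 = output.

Definition polytime_algorithm (I : Type) (O : I -> Type) (encI : I -> tree)
    (encO : forall x : I, O x -> tree) (ok : forall x : I, O x -> Prop) : Prop :=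
  exists (p : cmd) (a d : nat), forall x : I, exists (time : nat) (y : O x),
    [/\ runs_to p (encI x) time (encO x y),
        time <= a * tsize (encI x) ^ d + a
      & ok x y].

Definition enc_seq (s : seq tree) : tree := foldr Node Leaf s.

Definition enc_bool (b : bool) : tree := if b then Node Leaf Leaf else Leaf.

Definition enc_unary (n : nat) : tree := enc_seq (nseq n Leaf).

Fixpoint enc_pos (p : positive) : tree :=
  match p with
  | xH => Node (enc_bool true) Leaf
  | xO q => Node (enc_bool false) (enc_pos q)
  | xI q => Node (enc_bool true) (enc_pos q)
  end.

(* Binary, least significant bit first. *)
Definition enc_binary (n : nat) : tree :=
  if bin_of_nat n is Npos p then enc_pos p else Leaf.

(* Lowest terms; the sign is dropped, as only weights >= 0 are encoded. *)
Definition enc_weight (q : rat) : tree :=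
  Node (enc_binary `|numq q|%N) (enc_binary `|denq q|%N).

Definition enc_set (n : nat) (A : {set 'I_n}) : tree :=
  enc_seq [seq enc_bool (v \in A) | v <- enum 'I_n].

Definition enc_matrix (n : nat) (entry : 'I_n -> 'I_n -> tree) : tree :=
  enc_seq [seq enc_seq [seq entry i j | j <- enum 'I_n] | i <- enum 'I_n].

Record graph : Type := Graph {
  graph_order : nat;
  edges : {set {set 'I_graph_order}};
  edges_card2 : forall e : {set 'I_graph_order}, e \in edges -> #|e| = 2
}.

Definition enc_graph (G : graph) : tree :=
  enc_matrix (fun i j : 'I_(graph_order G) => enc_bool ([set i; j] \in edges G)).

Definition cut_size (G : graph) (U : {set 'I_(graph_order G)}) : nat :=
  #|[set e in edges G | #|e :&: U| == 1]|.

Definition maxcut_opt (G : graph) : nat :=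
  \max_(U : {set 'I_(graph_order G)}) cut_size U.

Definition maxcut_approximable (R : realType) (beta : R) : Prop :=
  @polytime_algorithm graph (fun G => {set 'I_(graph_order G)})
    enc_graph (fun G U => enc_set U)
    (fun G U => (beta * (maxcut_opt G)%:R <= (cut_size U)%:R)%R).

Record mp_instance : Type := MPInstance {
  mp_graph : graph;
  mp_weight : {set 'I_(graph_order mp_graph)} -> rat;
  mp_weight_ge0 : forall e : {set 'I_(graph_order mp_graph)},
    e \in edges mp_graph -> (0 <= mp_weight e)%R;
  mp_k : nat;
  mp_k_gt0 : 0 < mp_k;
  mp_terminal : 'I_mp_k -> 'I_(graph_order mp_graph);
  mp_terminal_inj : injective mp_terminal
}.

Definition mp_vertex (I : mp_instance) : finType := 'I_(graph_order (mp_graph I)).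

Definition mp_solution (I : mp_instance) : Type := 'I_(mp_k I) -> {set mp_vertex I}.

Definition enc_mp_instance (I : mp_instance) : tree :=
  Node
    (enc_matrix (fun i j : 'I_(graph_order (mp_graph I)) =>
       if [set i; j] \in edges (mp_graph I)
       then enc_weight (mp_weight [set i; j]) else Leaf))
    (enc_seq [seq enc_unary (mp_terminal i) | i <- enum 'I_(mp_k I)]).

Definition enc_mp_solution (I : mp_instance) (S : mp_solution I) : tree :=
  enc_seq [seq enc_set (S i) | i <- enum 'I_(mp_k I)].

Definition coverage (I : mp_instance) (A : {set mp_vertex I}) : rat :=
  (\sum_(e in edges (mp_graph I) | e :&: A != set0) mp_weight e)%R.

Definition mp_cost (I : mp_instance) (S : mp_solution I) : rat :=
  (\sum_(i < mp_k I) coverage (S i))%R.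

Definition mp_feasible (I : mp_instance) (S : mp_solution I) : Prop :=
  [/\ \bigcup_(i < mp_k I) S i = [set: mp_vertex I],
      forall i j : 'I_(mp_k I), i != j -> [disjoint S i & S j]
    & forall i : 'I_(mp_k I), mp_terminal i \in S i].

Definition mp_optimum (I : mp_instance) (c : rat) : Prop :=
  (exists2 S : mp_solution I, mp_feasible S & mp_cost S = c) /\
  (forall S : mp_solution I, mp_feasible S -> (c <= mp_cost S)%R).

Definition graph_coverage_mp_approximable (R : realType) (alpha : R) : Prop :=
  @polytime_algorithm mp_instance mp_solution enc_mp_instance enc_mp_solution
    (fun I S => mp_feasible S /\
       exists2 c : rat, mp_optimum I c & (ratr (mp_cost S) <= alpha * ratr c)%R).

(* Main.v *)
(* Since the parts S_i partition V, the coverage cost of a solution is the total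
   edge weight plus the weight of the edges cut by the partition, so the problem
   is multiway cut with the total weight added.  With three terminals t0, t1, t2,
   replace every edge {i, j} of the Max-cut instance, once in each direction, by
   inner vertices p, q, r, s and weighted edges
     p-t0 2, p-t2 2, p-i 1, q-t1 2, q-t2 2, q-j 1, q-p 1,
     r-t0 2, r-i 2, s-t1 2, s-i 2.
   For given labels of i and j the two gadgets together cost at least 54, with
   one unit saved if exactly one of i and j is labelled t0; this is attained when
   both labels are t0 or t1.  Hence the optimum is 54 m - mc, where mc >= m / 2 is
   the maximum cut, and an alpha-approximate solution yields a cut of size at
   least 54 m - alpha (54 m - mc) >= (108 - 107 alpha) mc >= (164 - 163 alpha) mc.

   Polynomial time is handled by closing the functions on trees computable in
   polynomial time under composition, pairing, conditionals and folds over lists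
   whose accumulators stay polynomially bounded. *)

Require Import Defs.
From mathcomp Require Import all_boot all_order all_algebra.
From mathcomp Require Import reals.
From mathcomp Require Import boolp zify lra.
Import Defs.
Import Order.TTheory GRing.Theory Num.Theory.

Set Implicit Arguments.
Unset Strict Implicit.
Unset Printing Implicit Defensive.

(** * Polynomial-time functions on trees *)

(** The base [n + 2] is at least 2, so constants and sums are absorbed by a larger exponent and
    every bound stays a single power. *)
Definition polyb (b : nat -> nat) : Prop := exists k, forall n, b n <= (n + 2) ^ k.

Lemma polyb_const c : polyb (fun=> c).
Proof.
exists c => n; apply: leq_trans (ltnW (ltn_expl c (isT : 1 < 2))) _.
by case: c => // c; rewrite leq_exp2r ?leq_addl.
Qed.

Lemma polyb_id : polyb id.
Proof. by exists 1 => n; rewrite expn1 leq_addr. Qed.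

Lemma polyb_add b1 b2 : polyb b1 -> polyb b2 -> polyb (fun n => b1 n + b2 n).
Proof.
move=> [k1 h1] [k2 h2]; exists (k1 + k2).+1 => n.
have x2 : 2 <= n + 2 by rewrite leq_addl.
have x0 : 0 < n + 2 by apply: ltnW.
apply: (@leq_trans ((n + 2) ^ (k1 + k2) + (n + 2) ^ (k1 + k2))).
  apply: leq_add.
    by apply: leq_trans (h1 n) _; rewrite leq_pexp2l ?leq_addr.
  by apply: leq_trans (h2 n) _; rewrite leq_pexp2l ?leq_addl.
by rewrite addnn -mul2n expnS leq_mul2r x2 orbT.
Qed.

Lemma polyb_mul b1 b2 : polyb b1 -> polyb b2 -> polyb (fun n => b1 n * b2 n).
Proof.
move=> [k1 h1] [k2 h2]; exists (k1 + k2) => n.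
by rewrite expnD leq_mul.
Qed.

Lemma polyb_exp b k : polyb b -> polyb (fun n => b n ^ k).
Proof.
move=> hb; elim: k => [|k IH]; first exact: polyb_const.
by have [j hj] := polyb_mul hb IH; exists j => n; rewrite expnS.
Qed.

Ltac polyb_tac :=
  repeat first [ exact: polyb_const | exact: polyb_id | apply: polyb_add
               | apply: polyb_mul | apply: polyb_exp ].

Lemma leq_pow2 k m n : m <= n -> (m + 2) ^ k <= (n + 2) ^ k.
Proof. by move=> h; case: k => // k; rewrite leq_exp2r ?leq_add2r. Qed.

Lemma tsize_gt0 t : 0 < tsize t. Proof. by case: t. Qed.

Lemma eval_size_le s e : tsize (eval s e) <= ecost s e.
Proof. by case: e => *; rewrite /= leq_addr. Qed.

(** An assigned value is no larger than the cost of evaluating its expression, so time bounds the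
    growth of every register; output sizes are bounded this way. *)
Lemma exec_size c s n s' : exec c s n s' -> forall y, tsize (s' y) <= tsize (s y) + n.
Proof.
elim=> {c s n s'} /=.
- by move=> s y; rewrite leq_addr.
- move=> s x e y; rewrite /update; case: eqP => _; last by rewrite leq_addr.
  by have := eval_size_le s e; lia.
- by move=> c1 c2 s s1 s2 n1 n2 _ h1 _ h2 y; have := h1 y; have := h2 y; lia.
- by move=> e c1 c2 s s1 n1 _ _ h y; have := h y; lia.
- by move=> e c1 c2 s s1 n1 _ _ h y; have := h y; lia.
- by move=> e c s s1 s2 n1 n2 _ _ h1 _ h2 y; have := h1 y; have := h2 y; lia.
- by move=> e c s _ y; lia.
Qed.

Definition runs (c : cmd) (s s' : store) (b : nat) : Prop :=
  exists2 t, t <= b & exec c s t s'.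

Lemma runs_le c s s' b b' : b <= b' -> runs c s s' b -> runs c s s' b'.
Proof. by move=> h [t ht ex]; exists t => //; apply: leq_trans h. Qed.

Lemma runs_assign s x e s' :
  s' = update s x (eval s e) -> runs (CAssign x e) s s' (ecost s e).+1.
Proof. by move=> ->; exists (ecost s e).+1 => //; apply: XAssign. Qed.

Lemma runs_seq c1 c2 s s1 s2 b1 b2 :
  runs c1 s s1 b1 -> runs c2 s1 s2 b2 -> runs (CSeq c1 c2) s s2 (b1 + b2).+1.
Proof.
move=> [t1 h1 e1] [t2 h2 e2]; exists (t1 + t2).+1; last exact: XSeq e1 e2.
by rewrite ltnS leq_add.
Qed.

Definition clean (K : nat) (s : store) : Prop := forall y, 0 < y < K -> s y = Leaf.

(* The scratch registers 1, ..., K - 1 are empty before and after the run, and the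
   registers from K on are left alone, so programs can be nested freely. *)
Definition computes (K : nat) (c : cmd) (f : tree -> tree) (k : nat) : Prop :=
  forall s, clean K s ->
  runs c s (update s 0 (f (s 0))) ((tsize (s 0) + 2) ^ k).

Definition ptime (f : tree -> tree) : Prop := exists K c k, computes K c f k.

Lemma clean_le K K' s : K <= K' -> clean K' s -> clean K s.
Proof. by move=> h cl y hy; apply: cl; lia. Qed.

Lemma computes_le K K' c f k : K <= K' -> computes K c f k -> computes K' c f k.
Proof. by move=> h hc s cl; apply: hc; apply: clean_le cl. Qed.

Lemma ptime_intro K c f b : polyb b ->
  (forall s, clean K s -> runs c s (update s 0 (f (s 0))) (b (tsize (s 0)))) ->
  ptime f.
Proof. by move=> [k hk] h; exists K, c, k => s /h; apply: runs_le. Qed.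

Lemma clean_init K v : clean K (init_store v).
Proof. by move=> [|y]. Qed.

Lemma computes_size K c f k x :
  computes K c f k -> tsize (f x) <= tsize x + (tsize x + 2) ^ k.
Proof.
move=> /(_ _ (@clean_init K x))[t ht /exec_size/(_ 0)].
rewrite /update /init_store /= in ht *; lia.
Qed.

Lemma ptime_size f : ptime f ->
  exists k, forall x, tsize (f x) <= (tsize x + 2) ^ k.
Proof.
move=> [K [c [k h]]].
have [j hj] : polyb (fun n => n + (n + 2) ^ k) by polyb_tac.
by exists j => x; apply: leq_trans (computes_size x h) (hj _).
Qed.

Lemma clean_update0 K s v : clean K s -> clean K (update s 0 v).
Proof. by move=> cl [|y] // /cl. Qed.

Lemma clean_updateK K K' s v : K <= K' -> clean K s -> clean K (update s K' v).
Proof.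
move=> le cl y hy; rewrite /update; case: eqP => [E|_]; last exact: cl.
by exfalso; lia.
Qed.

Lemma update_upd0 s v w : update (update s 0 v) 0 w = update s 0 w.
Proof. by apply: funext => y; rewrite /update; case: eqP. Qed.

Lemma ptime_id : ptime id.
Proof.
apply: (@ptime_intro 1 (CAssign 0 (EVar 0)) _ (fun n => n + 0 + 1)); first by polyb_tac.
by move=> s _; apply: runs_le (runs_assign _) => /=; [lia|].
Qed.

(** * Closure under composition, pairing and conditionals *)

Lemma ptime_comp g f : ptime g -> ptime f -> ptime (fun x => g (f x)).
Proof.
move=> [K1 [c1 [k1 h1]]] [K2 [c2 [k2 h2]]].
have b2 := computes_size _ h2.
apply: (@ptime_intro (maxn K1 K2) (CSeq c2 c1) _
  (fun n => ((n + 2) ^ k2 + (n + (n + 2) ^ k2 + 2) ^ k1) + 1)); first by polyb_tac.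
move=> s cl; rewrite addn1; apply: runs_seq.
  by apply: h2; apply: clean_le cl; apply: leq_maxr.
rewrite -(update_upd0 s (f (s 0)) (g (f (s 0)))).
have cl1 : clean K1 (update s 0 (f (s 0))).
  by apply/clean_update0/clean_le/cl/leq_maxl.
by apply: runs_le (h1 _ cl1); rewrite /update /=; apply: leq_pow2.
Qed.

Lemma ptime_hd f : ptime f -> ptime (fun x => thd (f x)).
Proof.
apply: (@ptime_comp thd).
apply: (@ptime_intro 1 (CAssign 0 (EHd (EVar 0))) _ (fun n => n + n + 1)); first by polyb_tac.
move=> s _; apply: runs_le (runs_assign _) => //=.
by case: (s 0) => //= l r; lia.
Qed.

Lemma ptime_tl f : ptime f -> ptime (fun x => ttl (f x)).
Proof.
apply: (@ptime_comp ttl).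
apply: (@ptime_intro 1 (CAssign 0 (ETl (EVar 0))) _ (fun n => n + n + 1)); first by polyb_tac.
move=> s _; apply: runs_le (runs_assign _) => //=.
by case: (s 0) => //= l r; lia.
Qed.

Fixpoint equote (t : tree) : expr :=
  if t is Node l r then ECons (equote l) (equote r) else ELeaf.

Lemma eval_equote s t : eval s (equote t) = t.
Proof. by elim: t => //= l -> r ->. Qed.

Lemma ecost_equote s t : ecost s (equote t) = ecost (fun=> Leaf) (equote t).
Proof. by elim: t => //= l -> r ->; rewrite !eval_equote. Qed.

Lemma ptime_const t : ptime (fun=> t).
Proof.
apply: (@ptime_intro 1 (CAssign 0 (equote t)) _ (fun n => (ecost (fun=> Leaf) (equote t)).+1)).
  exact: polyb_const.
move=> s _; rewrite -(ecost_equote s); apply: runs_assign.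
by rewrite eval_equote.
Qed.

(** Registers [K] and [K.+1], above the scratch space of both programs, keep the input and the first
    result while the other value is computed; both are emptied at the end. *)
Lemma ptime_node f g : ptime f -> ptime g -> ptime (fun x => Node (f x) (g x)).
Proof.
move=> [K1 [c1 [k1 h1]]] [K2 [c2 [k2 h2]]].
have b1 := computes_size _ h1; have b2 := computes_size _ h2.
pose K := (maxn K1 K2).+1.
have {}h1 : computes K c1 f k1 by apply: computes_le h1; rewrite /K; lia.
have {}h2 : computes K c2 g k2 by apply: computes_le h2; rewrite /K; lia.
have K0 : 0 < K by [].
move: K K0 h1 h2 => K K0 h1 h2.
apply: (@ptime_intro K.+2
  (CSeq (CAssign K (EVar 0)) (CSeq c1 (CSeq (CAssign K.+1 (EVar 0))
    (CSeq (CAssign 0 (EVar K)) (CSeq c2 (CSeq (CAssign 0 (ECons (EVar K.+1) (EVar 0)))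
    (CSeq (CAssign K ELeaf) (CAssign K.+1 ELeaf)))))))) _
  (fun n => (n + (n + 2) ^ k1 + (n + 2) ^ k2) * 10 + 100)); first by polyb_tac.
move=> s cl.
have sK : s K = Leaf by apply: cl; lia.
have sK1 : s K.+1 = Leaf by apply: cl; lia.
have clK : clean K s by apply: clean_le cl; lia.
set x := s 0.
apply: runs_le; last first.
  apply: runs_seq; first exact: runs_assign.
  apply: runs_seq.
    by apply: h1; apply: clean_updateK.
  apply: runs_seq; first exact: runs_assign.
  apply: runs_seq; first exact: runs_assign.
  apply: runs_seq.
    by apply: h2; do !(apply: clean_update0 || (apply: clean_updateK; first by lia)).
  apply: runs_seq; first exact: runs_assign.
  apply: runs_seq; first exact: runs_assign.
  apply: runs_assign.
  apply: funext => y.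
  have e1 : 0 == K = false by lia.
  have e2 : K == K.+1 = false by lia.
  have e3 : K.+1 == K = false by lia.
  have e4 : K == 0 = false by lia.
  by rewrite /update /= ?eqxx ?e1 ?e2 ?e3 ?e4 /=; do !case: eqP => //=; move=> *; subst.
have e1 : 0 == K = false by lia.
have e2 : K == K.+1 = false by lia.
have e3 : K.+1 == K = false by lia.
have e4 : K == 0 = false by lia.
rewrite /update /= ?eqxx ?e1 ?e2 ?e3 ?e4 /= -/x.
have := b1 x; have := b2 x.
lia.
Qed.

(** The value of the test is first paired with the input, so the chosen branch still finds the input
    in the tail. *)
Lemma ptime_if f g h : ptime f -> ptime g -> ptime h ->
  ptime (fun x => if truthy (f x) then g x else h x).
Proof.
move=> pf pg ph.
suff : ptime (fun x => if truthy (thd x) then g (ttl x) else h (ttl x)).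
  by move=> /ptime_comp/(_ (ptime_node pf ptime_id)).
have pg' := ptime_comp pg (ptime_tl ptime_id).
have ph' := ptime_comp ph (ptime_tl ptime_id).
case: pg' => [K1 [c1 [k1 h1]]]; case: ph' => [K2 [c2 [k2 h2]]].
apply: (@ptime_intro (maxn K1 K2) (CIf (EHd (EVar 0)) c1 c2) _
  (fun n => (n + n + (n + 2) ^ k1 + (n + 2) ^ k2) + 1)); first by polyb_tac.
move=> s cl.
have [t1 l1 e1] := h1 s (clean_le (leq_maxl _ _) cl).
have [t2 l2 e2] := h2 s (clean_le (leq_maxr _ _) cl).
have le : ecost s (EHd (EVar 0)) <= tsize (s 0) + tsize (s 0).
  by rewrite /=; case: (s 0) => //= l r; lia.
case tr : (truthy (thd (s 0))).
  exists (ecost s (EHd (EVar 0)) + t1).+1; last exact: XIfTrue.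
  by move: le l1; lia.
exists (ecost s (EHd (EVar 0)) + t2).+1; last by apply: XIfFalse => //=; rewrite tr.
by move: le l2; lia.
Qed.

(* Every tree is the encoding of exactly one list. *)
Fixpoint dec (t : tree) : seq tree := if t is Node e r then e :: dec r else [::].

Lemma decK : cancel dec enc_seq.
Proof. by elim=> //= e _ r ->. Qed.

Lemma enc_seqK : cancel enc_seq dec.
Proof. by elim=> //= e r ->. Qed.

(** The constant [c] is a context: it passes the values of outer variables to [step], which sees the
    element, then the accumulator, then the context. *)
Definition tfold (step : tree -> tree) (c a l : tree) : tree :=
  foldl (fun a e => step (Node e (Node a c))) a (dec l).

Lemma size_dec t : size (dec t) < tsize t.
Proof. by elim: t => //= e _ r; lia. Qed.

Lemma tsize_enc_seq s : tsize (enc_seq s) = sumn [seq (tsize t).+1 | t <- s] + 1.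
Proof. by elim: s => //= t s ->; lia. Qed.

(** Iterating a polynomial-time step could make the accumulator grow exponentially; the size
    assumption on all folds, applied to prefixes of the list, bounds every intermediate accumulator.
    A WHILE loop then keeps the remaining list in [K] and the context in [K.+1]. *)
Lemma ptime_fold_core step : ptime step ->
  (exists k, forall c a l, tsize (tfold step c a l) <= (tsize c + tsize a + tsize l + 2) ^ k) ->
  ptime (fun x => tfold step (ttl (ttl x)) (thd (ttl x)) (thd x)).
Proof.
move=> [K [c [k hs]]] [j hj].
have {}hs : computes K.+1 c step k by apply: computes_le hs; lia.
move: K.+1 (isT : 0 < K.+1) hs => {}K K0 hs.
have e1 : 0 == K = false by lia.
have e2 : K == K.+1 = false by lia.
have e3 : K.+1 == K = false by lia.
have e4 : K == 0 = false by lia.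
pose body := CSeq (CAssign 0 (ECons (EHd (EVar K)) (ECons (EVar 0) (EVar K.+1))))
  (CSeq c (CAssign K (ETl (EVar K)))).
pose loop := CWhile (EVar K) body.
pose st (s : store) (v a l : tree) := update (update (update s K.+1 v) K l) 0 a.
(* [T] bounds the remaining list and [Q] the accumulator after every prefix; the bound is the number
   of loop tests times a uniform cost per round. *)
have loopP (s : store) (v : tree) (Q T : nat) : clean K s ->
   forall l a, tsize l <= T ->
   (forall l1 l2, dec l = l1 ++ l2 -> tsize (tfold step v a (enc_seq l1)) <= Q) ->
   runs loop (st s v a l) (st s v (tfold step v a l) Leaf)
     ((size (dec l)).+1 * ((T + Q + tsize v) * 10 + (T + Q + tsize v + 2 + 2) ^ k + 10)).
  move=> cl; elim=> [|e _ r IH] a hT hQ.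
    exists (ecost (st s v a Leaf) (EVar K)).+1; first by rewrite /st /update /= ?eqxx ?e4 /=; lia.
    by apply: XWhileFalse; rewrite /= /st /update ?eqxx e4.
  pose a' := step (Node e (Node a v)).
  have hQa : tsize a <= Q by have := hQ [::] (dec (Node e r)) erefl.
  have hQa' : tsize a' <= Q by have := hQ [:: e] (dec r) erefl.
  have [||t2 l2 ex2] := IH a'.
  - by move: hT => /=; lia.
  - by move=> l1 l2 E; apply: (hQ (e :: l1) l2); rewrite /= E.
  have [t1 l1 ex1] : runs body (st s v a (Node e r)) (st s v a' r)
     ((T + Q + tsize v) * 8 + (T + Q + tsize v + 2 + 2) ^ k + 9).
    apply: runs_le; last first.
      apply: runs_seq; first exact: runs_assign.
      apply: runs_seq.
        by apply: hs; do !(apply: clean_update0 || (apply: clean_updateK; first by lia)).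
      apply: runs_assign.
      apply: funext => y.
      rewrite /st /update /= ?eqxx ?e1 ?e2 ?e3 ?e4 /=.
      by do !case: eqP => //=; move=> *; subst.
    rewrite /st /update /= ?eqxx ?e1 ?e2 ?e3 ?e4 /=.
    have : (tsize e + (tsize a + tsize v).+1).+1 <= T + Q + tsize v + 2.
      by move: hT hQa => /=; lia.
    move=> /(leq_pow2 k); move: hT hQa hQa' => /=; lia.
  exists (ecost (st s v a (Node e r)) (EVar K) + t1 + t2).+1; last first.
    apply: XWhileTrue ex1 ex2.
    by rewrite /= /st /update ?eqxx e4.
  rewrite /= {1}/st /update ?eqxx e4 /= mulSn.
  by move: hT l1 l2 => /=; lia.
pose Q n := (n + 2 + 2) ^ j.
apply: (@ptime_intro K.+2
  (CSeq (CAssign K.+1 (ETl (ETl (EVar 0)))) (CSeq (CAssign K (EHd (EVar 0)))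
  (CSeq (CAssign 0 (EHd (ETl (EVar 0)))) (CSeq loop (CAssign K.+1 ELeaf))))) _
  (fun n => (n + 1) * ((n + Q n + n) * 10 + (n + Q n + n + 2 + 2) ^ k + 10)
     + (10 * n + 20))); first by rewrite /Q; polyb_tac.
move=> s cl.
have sK : s K = Leaf by apply: cl; lia.
have sK1 : s K.+1 = Leaf by apply: cl; lia.
have clK : clean K s by apply: clean_le cl; lia.
set x := s 0.
have hth t : tsize (thd t) <= tsize t by case: t => //= *; lia.
have htl t : tsize (ttl t) <= tsize t by case: t => //= *; lia.
(* The [+ 2] pays for the leaves that [thd] and [ttl] return by default when [t] is not a full
   triple. *)
have h3 t : tsize (ttl (ttl t)) + tsize (thd (ttl t)) + tsize (thd t) <= tsize t + 2.
  by case: t => //= a [|b d] /=; lia.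
set u := ttl (ttl x); set a := thd (ttl x); set l := thd x.
have l_le : tsize l <= tsize x by apply: hth.
have r4 := loopP s u (Q (tsize x)) (tsize x) clK l a l_le.
have {r4} [|t4 l4 ex4] := r4.
  move=> l1 l2 E; apply: leq_trans (hj _ _ _) _; apply: leq_pow2.
  have : tsize (enc_seq l1) <= tsize l.
    by rewrite -(decK l) E !tsize_enc_seq map_cat sumn_cat; lia.
  by have := h3 x; rewrite -/u -/a -/l; lia.
apply: runs_le; last first.
  apply: (@runs_seq _ _ _ (update s K.+1 u)); first exact: runs_assign.
  apply: (@runs_seq _ _ _ (update (update s K.+1 u) K l)).
    by apply: runs_assign; rewrite /= /update.
  apply: (@runs_seq _ _ _ (st s u a l)).
    by apply: runs_assign; rewrite /= /st /update e1.
  apply: runs_seq; first by exists t4; [exact: leqnn|exact: ex4].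
  apply: runs_assign.
  apply: funext => y.
  rewrite /st /update /= ?eqxx ?e1 ?e2 ?e3 ?e4 /=.
  by do !case: eqP => //=; move=> *; subst.
rewrite /update /= ?eqxx ?e1 ?e2 ?e3 ?e4 /= -/x.
have := hth x; have := htl x; have := htl (ttl x); have := hth (ttl x).
have : (size (dec l)).+1 <= tsize x + 1 by have := size_dec l; lia.
move: l4 => /leq_trans l4 /leq_mul lm.
have ul : tsize u <= tsize x by apply: leq_trans (htl _) (htl _).
have {}l4 := l4 _ (lm _ _ _).
have {l4 lm} l4 : t4 <= (tsize x + 1) *
    ((tsize x + Q (tsize x) + tsize x) * 10 +
     (tsize x + Q (tsize x) + tsize x + 2 + 2) ^ k + 10).
  apply: l4; rewrite leq_add2r; apply: leq_add; first by lia.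
  by apply: leq_pow2; lia.
move: l4; set Z := (X in t4 <= X) => l4.
by rewrite -/u -/a -/l; lia.
Qed.

Lemma ptime_fold step c a l : ptime step ->
  (exists k, forall c a l, tsize (tfold step c a l) <= (tsize c + tsize a + tsize l + 2) ^ k) ->
  ptime c -> ptime a -> ptime l -> ptime (fun x => tfold step (c x) (a x) (l x)).
Proof.
move=> ps hk pc pa pl.
exact: ptime_comp (ptime_fold_core ps hk) (ptime_node pl (ptime_node pa pc)).
Qed.

(** * Calling an oracle *)

Definition agree (K : nat) (s s' : store) : Prop := forall y, y < K -> s y = s' y.

Fixpoint ebound (e : expr) : nat :=
  match e with
  | EVar x => x.+1
  | ELeaf => 0
  | ECons e1 e2 => maxn (ebound e1) (ebound e2)
  | EHd e1 | ETl e1 => ebound e1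
  end.

Fixpoint cbound (c : cmd) : nat :=
  match c with
  | CSkip => 0
  | CAssign x e => maxn x.+1 (ebound e)
  | CSeq c1 c2 => maxn (cbound c1) (cbound c2)
  | CIf e c1 c2 => maxn (ebound e) (maxn (cbound c1) (cbound c2))
  | CWhile e c1 => maxn (ebound e) (cbound c1)
  end.

Lemma eval_agree K s s' e : ebound e <= K -> agree K s s' ->
  eval s e = eval s' e /\ ecost s e = ecost s' e.
Proof.
move=> + ag; elim: e => //= [x|e1 IH1 e2 IH2|e IH|e IH].
- by move=> /ag ->.
- by rewrite geq_max => /andP[/IH1[-> ->] /IH2[-> ->]].
- by move=> /IH[-> ->].
- by move=> /IH[-> ->].
Qed.

(** All that is known of an oracle's program is which registers its text mentions. Those from [K] on
    influence nothing and are left alone, so the original input can survive there. *)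
Lemma exec_frame K c s t s' : exec c s t s' -> cbound c <= K ->
  forall s1, agree K s s1 -> exec c s1 t (fun y => if y < K then s' y else s1 y).
Proof.
have same s0 s1 : agree K s0 s1 -> (fun y => if y < K then s0 y else s1 y) = s1.
  by move=> ag; apply: funext => y; case: ltnP => // /ag.
have step s0 s1 : agree K s0 (fun y => if y < K then s0 y else s1 y).
  by move=> y ->.
have merge s0 s1 s2 : (fun y => if y < K then s2 y else (if y < K then s0 y else s1 y))
    = (fun y => if y < K then s2 y else s1 y) :> store.
  by apply: funext => y; case: ltnP.
elim=> {c s t s'} /=.
- by move=> s _ s1 ag; rewrite same //; apply: XSkip.
- move=> s x e; rewrite geq_max => /andP[hx he] s1 ag.
  have [Ee Ec] := eval_agree he ag.
  suff -> : (fun y => if y < K then update s x (eval s e) y else s1 y)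
      = update s1 x (eval s1 e) by rewrite Ec; apply: XAssign.
  apply: funext => y; rewrite /update; case: eqP => [->|_]; first by rewrite hx.
  by case: ltnP => // /ag.
- move=> c1 c2 s s1 s2 n1 n2 _ IH1 _ IH2; rewrite geq_max => /andP[h1 h2] s3 ag.
  apply: XSeq (IH1 h1 _ ag) _.
  by rewrite -(merge s1 s3 s2); apply: IH2.
- move=> e c1 c2 s s1 n1 tr _ IH; rewrite !geq_max => /and3P[he h1 _] s3 ag.
  have [Ee Ec] := eval_agree he ag.
  by rewrite Ec; apply: XIfTrue; rewrite -?Ee //; apply: IH.
- move=> e c1 c2 s s1 n1 tr _ IH; rewrite !geq_max => /and3P[he _ h2] s3 ag.
  have [Ee Ec] := eval_agree he ag.
  by rewrite Ec; apply: XIfFalse; rewrite -?Ee //; apply: IH.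
- move=> e c s s1 s2 n1 n2 tr _ IH1 _ IH2 h s3 ag.
  have /andP[he hc] : (ebound e <= K) && (cbound c <= K) by rewrite -geq_max.
  have [Ee Ec] := eval_agree he ag.
  rewrite Ec; apply: XWhileTrue (IH1 hc _ ag) _; first by rewrite -Ee.
  by rewrite -(merge s1 s3 s2); apply: IH2.
- move=> e c s tr h s1 ag.
  have /andP[he hc] : (ebound e <= K) && (cbound c <= K) by rewrite -geq_max.
  have [Ee Ec] := eval_agree he ag.
  by rewrite same // Ec; apply: XWhileFalse; rewrite -Ee.
Qed.

(** An oracle may leave anything in its registers; they must be emptied before a program that
    expects clean scratch space. *)
Fixpoint creset (K : nat) : cmd :=
  if K is K'.+1 then CSeq (creset K') (CAssign K ELeaf) else CSkip.

Lemma creset_runs K s :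
  runs (creset K) s (fun y => if 0 < y <= K then Leaf else s y) (3 * K + 1).
Proof.
elim: K => [|K IH] /=.
  exists 1 => //.
  rewrite (_ : (fun _ => _) = s); first exact: XSkip.
  by apply: funext => -[|y].
apply: runs_le; last first.
  apply: runs_seq IH _; apply: runs_assign; apply: funext => y.
  rewrite /update /=; case: eqP => [->|ne]; first by rewrite leqnn.
  by rewrite (_ : (0 < y <= K.+1) = (0 < y <= K)) //; lia.
by rewrite /=; lia.
Qed.

(* An oracle that is correct only on the encodings of its instances, run between
   two functions defined on all trees; the original input is kept in a register
   that the oracle does not use. *)
Lemma polytime_reduction (I J : Type) (OI : I -> Type) (OJ : J -> Type)
    (encI : I -> tree) (encJ : J -> tree)
    (encOI : forall x : I, OI x -> tree) (encOJ : forall x : J, OJ x -> tree)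
    (okI : forall x : I, OI x -> Prop) (okJ : forall x : J, OJ x -> Prop)
    (pre post : tree -> tree) (inst : I -> J) (back : forall x : I, OJ (inst x) -> OI x) :
  ptime pre -> ptime post ->
  (forall x, pre (encI x) = encJ (inst x)) ->
  (forall x y, okJ (inst x) y -> post (Node (encOJ (inst x) y) (encI x)) = encOI x (back x y)) ->
  (forall x y, okJ (inst x) y -> okI x (back x y)) ->
  polytime_algorithm encJ encOJ okJ -> polytime_algorithm encI encOI okI.
Proof.
move=> ppre [K2 [c2 [k2 h2]]] hpre hpost hok [p [a [d hp]]].
have [j hj] := ptime_size ppre.
move: ppre => [K1 [c1 [k1 h1]]].
pose K := (maxn (cbound p) (maxn K1 K2)).+1.
have {}h1 : computes K c1 pre k1 by apply: computes_le h1; lia.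
have {}h2 : computes K c2 post k2 by apply: computes_le h2; lia.
have hK : cbound p <= K by lia.
pose main := CSeq (CAssign K (EVar 0)) (CSeq c1 (CSeq p (CSeq (creset K.-1)
   (CSeq (CAssign 0 (ECons (EVar 0) (EVar K))) (CSeq (CAssign K ELeaf) c2))))).
(* The oracle's time in terms of the size [n] of the original input: the instance it receives has
   size at most [(n + 2) ^ j]. *)
pose T n := a * ((n + 2) ^ j) ^ d + a.
pose S n := (n + 2) ^ j + T n.
pose B n := (n + 2) ^ k1 + T n + (S n + n + 1 + 2) ^ k2 + (3 * K + 1) + 2 * S n + 10 * n + 20.
have [D hD] : polyb B by rewrite /B /S /T; polyb_tac.
(* Encodings have size [n >= 1], so [n + 2 <= 3 * n] and [(n + 2) ^ D <= 3 ^ D * n ^ D]. *)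
exists main, (3 ^ D), D => x.
have [tp [y [[sp exp esp] htp hy]]] := hp (inst x).
suff [t ht ex] : runs main (init_store (encI x)) (init_store (encOI x (back x y))) (B (tsize (encI x))).
  exists t, (back x y); split; [by eexists; first exact: ex| |exact: hok].
  apply: leq_trans ht _; apply: leq_trans (hD _) _; apply: leq_trans _ (leq_addr _ _).
  rewrite -expnMn; case: (D) => // D'; rewrite leq_exp2r //.
  by have := tsize_gt0 (encI x); lia.
have K0 : 0 < K by [].
clearbody K.
have init0 v w : update (init_store v) 0 w = init_store w.
  by apply: funext => -[|].
pose e := encI x; pose z := encJ (inst x); pose o := encOJ (inst x) y.
pose reg v : store := update (init_store v) K e.
have zle : tsize z <= (tsize e + 2) ^ j by rewrite /z -hpre; apply: hj.
have ole : tsize o <= tsize z + tp.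
  by rewrite /o -esp; apply: leq_trans (exec_size exp 0) _; rewrite /init_store /=.
have tple : tp <= T (tsize e).
  apply: leq_trans htp _; rewrite leq_add2r leq_mul2l; apply/orP; right.
  by case: (d) => // d'; rewrite leq_exp2r.
have c_reg v : clean K (reg v).
  by apply: clean_updateK => //; apply: clean_init.
have neK : K == 0 = false by lia.
have neK' : 0 == K = false by lia.
apply: runs_le; last first.
  apply: (@runs_seq _ _ _ (reg e)); first by apply: runs_assign.
  apply: (@runs_seq _ _ _ (reg z)).
    have -> : reg z = update (reg e) 0 (pre (reg e 0)).
      have -> : reg e 0 = e by rewrite /reg /update neK'.
      rewrite hpre.
      apply: funext => u; rewrite /reg /update /init_store.
      by case: (eqVneq u 0) => [->|_]; rewrite ?neK'.
    exact: h1.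
  apply: runs_seq.
    exists tp; first exact: leqnn.
    by apply: (exec_frame exp hK (s1 := reg z)) => u; rewrite /reg /update; case: eqP => // ->; lia.
  apply: runs_seq; first exact: creset_runs.
  apply: (@runs_seq _ _ _ (reg (Node o e))).
    apply: runs_assign; apply: funext => u.
    have hf : (0 < K <= K.-1) = false by lia.
    rewrite [eval _ _]/= hf K0 ltnn esp -/o.
    rewrite /reg /update /init_store eqxx.
    case: (eqVneq u K) => [->|neu]; first by rewrite neK hf ltnn.
    case: (eqVneq u 0) => [_|u0] //.
    have -> : (0 < u <= K.-1) = (u < K) by lia.
    by case: ltnP.
  apply: (@runs_seq _ _ _ (init_store (Node o e))).
    apply: runs_assign; apply: funext => u.
    rewrite /reg /update /init_store /=; case: (eqVneq u K) => // ->.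
    by rewrite neK.
  rewrite -(hpost x y hy) -(init0 (Node o e) (post _)).
  exact: h2 (clean_init _).
have Ez v : reg v 0 = v by rewrite /reg /update neK'.
have EK v : reg v K = e by rewrite /reg /update eqxx.
rewrite !Ez /= K0 ltnn esp -/o.
have -> : (K <= K.-1) = false by lia.
have l1 : (tsize o + tsize e).+1 <= S (tsize e) + tsize e + 1.
  by rewrite /S; lia.
have := leq_pow2 k2 l1.
rewrite /B /init_store /= -/e EK.
have : 3 * K.-1 + 1 <= 3 * K + 1 by lia.
move: tple l1; rewrite /S; lia.
Qed.

(** * List functions on trees *)

Lemma dec_ext s t : dec s = dec t -> s = t.
Proof. exact: (can_inj decK). Qed.

Lemma tsize_cat s1 s2 :
  tsize (enc_seq (s1 ++ s2)) + 1 = tsize (enc_seq s1) + tsize (enc_seq s2).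
Proof. by rewrite !tsize_enc_seq map_cat sumn_cat; lia. Qed.

Lemma ptime_fold_poly step c a l b : ptime step -> polyb b ->
  (forall c a l, tsize (tfold step c a l) <= b (tsize c + tsize a + tsize l)) ->
  ptime c -> ptime a -> ptime l -> ptime (fun x => tfold step (c x) (a x) (l x)).
Proof.
move=> ps [k hk] hb; apply: ptime_fold => //; exists k => c' a' l'.
exact: leq_trans (hb _ _ _) (hk _).
Qed.

Definition tcatrev (a b : tree) : tree :=
  tfold (fun x => Node (thd x) (thd (ttl x))) Leaf b a.

Lemma dec_tcatrev a b : dec (tcatrev a b) = catrev (dec a) (dec b).
Proof. by rewrite /tcatrev /tfold /=; elim: (dec a) b => //= e s IH b; rewrite IH. Qed.

Lemma ptime_tcatrev f g : ptime f -> ptime g -> ptime (fun x => tcatrev (f x) (g x)).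
Proof.
move=> pf pg; apply: (@ptime_fold_poly _ _ _ _ id) pg pf.
- by apply: ptime_node; apply: ptime_hd; first exact: ptime_id; apply/ptime_tl/ptime_id.
- exact: polyb_id.
- move=> c a l; rewrite /tfold /= -[l in X in _ <= X]decK.
  elim: (dec l) a => [|e s IH] a /=; first by lia.
  by apply: leq_trans (IH _) _ => /=; lia.
- exact: ptime_const.
Qed.

(** A left fold can only push onto the front of its accumulator, so appending is done by reversing
    twice. *)
Definition tcat (a b : tree) : tree := tcatrev (tcatrev a Leaf) b.

Lemma dec_tcat a b : dec (tcat a b) = dec a ++ dec b.
Proof. by rewrite /tcat !dec_tcatrev !catrevE cats0 revK. Qed.

Lemma ptime_tcat f g : ptime f -> ptime g -> ptime (fun x => tcat (f x) (g x)).
Proof.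
by move=> pf pg; apply: ptime_tcatrev pg; apply: ptime_tcatrev => //; exact: ptime_const.
Qed.

Lemma tsize_tcat a b : tsize (tcat a b) + 1 = tsize a + tsize b.
Proof. by rewrite -[tcat a b]decK dec_tcat tsize_cat !decK. Qed.

Definition tflatmap (F : tree -> tree) (c l : tree) : tree :=
  tfold (fun x => tcat (thd (ttl x)) (F (Node (thd x) (ttl (ttl x))))) c Leaf l.

Lemma dec_tflatmap F c l :
  dec (tflatmap F c l) = flatten [seq dec (F (Node e c)) | e <- dec l].
Proof.
rewrite /tflatmap /tfold /=.
rewrite -[RHS]/(dec Leaf ++ flatten [seq dec (F (Node e c)) | e <- dec l]).
elim: (dec l) Leaf => [|e s IH] a /=; first by rewrite cats0.
by rewrite IH dec_tcat catA.
Qed.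

(** Each round appends a value of [F] whose size does not depend on the accumulator, so growth is
    additive: at most one polynomial term per element. *)
Lemma ptime_flatmap F c l :
  ptime F -> ptime c -> ptime l -> ptime (fun x => tflatmap F (c x) (l x)).
Proof.
move=> pF pc pl; have [k hk] := ptime_size pF.
apply: (@ptime_fold_poly _ _ _ _ (fun n => n + n * (n + 1 + 2) ^ k)) => //.
- apply: ptime_tcat; first by apply/ptime_hd/ptime_tl/ptime_id.
  apply: ptime_comp => //; apply: ptime_node; first by apply/ptime_hd/ptime_id.
  by apply/ptime_tl/ptime_tl/ptime_id.
- by polyb_tac.
- move=> c' a' l'.
  set n := tsize c' + tsize a' + tsize l'.
  suff : tsize (tfold (fun x => tcat (thd (ttl x)) (F (Node (thd x) (ttl (ttl x))))) c' a' l')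
     <= tsize a' + tsize l' * (n + 1 + 2) ^ k.
    move=> /leq_trans; apply; apply: leq_add; first by rewrite /n; lia.
    by apply: leq_mul => //; rewrite /n; lia.
  rewrite /tfold /=.
  have : tsize c' + tsize l' <= n by rewrite /n; lia.
  move: n => n hn.
  elim: l' a' hn => [|e _ r IH] a' hn /=; first by lia.
  apply: leq_trans (IH _ _) _; first by move: hn => /=; lia.
  have h1 : (tsize (Node e c') + 2) ^ k <= (n + 1 + 2) ^ k.
    by apply: leq_pow2; move: hn => /=; lia.
  have := leq_trans (hk (Node e c')) h1.
  by have := tsize_tcat a' (F (Node e c')); lia.
- exact: ptime_const.
Qed.

Definition tmap (F : tree -> tree) : tree -> tree -> tree :=
  tflatmap (fun x => Node (F x) Leaf).

Lemma dec_tmap F c l : dec (tmap F c l) = [seq F (Node e c) | e <- dec l].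
Proof. by rewrite dec_tflatmap /=; elim: (dec l) => //= e s ->. Qed.

Lemma ptime_map F c l :
  ptime F -> ptime c -> ptime l -> ptime (fun x => tmap F (c x) (l x)).
Proof. by move=> pF; apply: ptime_flatmap; apply: ptime_node => //; exact: ptime_const. Qed.

(** The unary index is the list folded over and [l] is the initial accumulator. *)
Definition tdrop (i l : tree) : tree := tfold (fun x => ttl (thd (ttl x))) Leaf l i.

Lemma dec_tdrop i l : dec (tdrop i l) = drop (size (dec i)) (dec l).
Proof.
rewrite /tdrop /tfold /=.
elim: (dec i) l => [|e s IH] l /=; first by rewrite drop0.
by rewrite IH; case: l => //= *; case: (size s).
Qed.

Lemma ptime_drop f g : ptime f -> ptime g -> ptime (fun x => tdrop (f x) (g x)).
Proof.
move=> pf pg; apply: (@ptime_fold_poly _ _ _ _ id) pg pf.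
- by apply/ptime_tl/ptime_hd/ptime_tl/ptime_id.
- exact: polyb_id.
- move=> c a l; rewrite /tfold /=.
  suff : tsize (foldl (fun a0 _ => ttl a0) a (dec l)) <= tsize a by lia.
  elim: (dec l) a => //= e s IH a; apply: leq_trans (IH _) _.
  by case: a => //= *; lia.
- exact: ptime_const.
Qed.

(** The next unary index is the list built so far with its entries blanked out, so no separate
    counter is carried. *)
Definition tindices (l : tree) : tree :=
  tfold (fun x => tcat (thd (ttl x))
           (Node (tmap (fun=> Leaf) Leaf (thd (ttl x))) Leaf)) Leaf Leaf l.

Lemma map_nseqLeaf (s : seq tree) : [seq Leaf | _ <- s] = nseq (size s) Leaf.
Proof. by elim: s => //= _ s ->. Qed.

Lemma dec_tindices l :
  dec (tindices l) = [seq enc_unary i | i <- iota 0 (size (dec l))].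
Proof.
rewrite /tindices /tfold; set step := (X in foldl X).
suff h s a : dec (foldl step a s) =
    dec a ++ [seq enc_unary i | i <- iota (size (dec a)) (size s)] by rewrite h.
elim: s a => [|e s IH] a /=; first by rewrite cats0.
rewrite IH /step /= dec_tcat /= size_cat /= addn1 -catA /=.
congr (_ ++ (_ :: _)); rewrite /enc_unary -map_nseqLeaf.
by apply: dec_ext; rewrite dec_tmap enc_seqK.
Qed.

Lemma tsize_unary n : tsize (enc_unary n) = n + n + 1.
Proof. by rewrite /enc_unary; elim: n => //= n ->; lia. Qed.

Lemma ptime_indices f : ptime f -> ptime (fun x => tindices (f x)).
Proof.
apply: (@ptime_fold_poly _ _ _ _ (fun n => n + n * (2 * n + 10))).
- apply: ptime_tcat; first by apply/ptime_hd/ptime_tl/ptime_id.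
  apply: ptime_node; last exact: ptime_const.
  by apply: ptime_map; [exact: ptime_const..|]; apply/ptime_hd/ptime_tl/ptime_id.
- by polyb_tac.
- move=> c a l; set n := _ + _ + _.
  set step := (X in tfold X).
  suff h : tsize (tfold step c a l) <= tsize a + size (dec l) * (2 * (size (dec a) + size (dec l)) + 10).
    apply: leq_trans h _; apply: leq_add; first by rewrite /n; lia.
    have := size_dec l; have := size_dec a => ha hl.
    by apply: leq_mul; rewrite /n; lia.
  rewrite /tfold; elim: (dec l) a {n} => [|e s IH] a /=; first by lia.
  apply: leq_trans (IH _) _.
  rewrite /step /= dec_tcat size_cat /=.
  have -> : tmap (fun=> Leaf) Leaf a = enc_unary (size (dec a)).
    by apply: dec_ext; rewrite dec_tmap enc_seqK map_nseqLeaf.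
  have := tsize_tcat a (Node (enc_unary (size (dec a))) Leaf).
  rewrite /= tsize_unary; nia.
- exact: ptime_const.
- exact: ptime_const.
Qed.

Ltac ptime_step := first
  [ exact: ptime_const | exact: ptime_id | assumption
  | apply: ptime_node | apply: ptime_hd | apply: ptime_tl | apply: ptime_if
  | apply: ptime_tcat | apply: ptime_flatmap | apply: ptime_map
  | apply: ptime_drop | apply: ptime_indices ].

(** Two unary numbers are equal when dropping either one's length from the other leaves nothing. *)
Definition tnat_eq (a b : tree) : tree :=
  if truthy (tdrop a b) then Leaf else if truthy (tdrop b a) then Leaf else enc_bool true.

Lemma truthy_dec t : truthy t = (0 < size (dec t)).
Proof. by case: t. Qed.

Lemma tnat_eqE i j : truthy (tnat_eq (enc_unary i) (enc_unary j)) = (i == j).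
Proof.
by rewrite /tnat_eq !truthy_dec !dec_tdrop !size_drop !enc_seqK !size_nseq; do 2?case: ifP => /=; lia.
Qed.

Lemma ptime_nat_eq f g : ptime f -> ptime g -> ptime (fun x => tnat_eq (f x) (g x)).
Proof. by move=> pf pg; rewrite /tnat_eq; do ! ptime_step. Qed.

(* A vertex of the reduced graph is named by a triple (kind, i, j): terminals
   are (k, 0, 0) with k < 3, the vertex i of the input is (3, i, 0), and the
   inner vertices of the gadget of the ordered pair (i, j) are (4, i, j), ...,
   (7, i, j). *)
Definition key : Type := (nat * nat * nat)%type.
Definition link : Type := (key * key * nat)%type.

Definition enc_key (k : key) : tree :=
  Node (enc_unary k.1.1) (Node (enc_unary k.1.2) (enc_unary k.2)).

Definition tkey_eq (a b : tree) : tree :=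
  if truthy (tnat_eq (thd a) (thd b)) then
    if truthy (tnat_eq (thd (ttl a)) (thd (ttl b))) then
      tnat_eq (ttl (ttl a)) (ttl (ttl b))
    else Leaf
  else Leaf.

Lemma tkey_eqE k l : truthy (tkey_eq (enc_key k) (enc_key l)) = (k == l).
Proof.
case: k l => [[a b] c] [[a' b'] c']; rewrite /tkey_eq /= !tnat_eqE !xpair_eqE.
by case: eqP => //= _; case: eqP => //= _; rewrite tnat_eqE.
Qed.

Lemma ptime_key_eq f g : ptime f -> ptime g -> ptime (fun x => tkey_eq (f x) (g x)).
Proof.
move=> pf pg; rewrite /tkey_eq.
by do ! (ptime_step || apply: ptime_nat_eq).
Qed.

(** * Cuts *)

(** An edge {a, b} arises from exactly the two ordered pairs (a, b) and (b, a). This links the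
    gadgets, indexed by ordered pairs, to sums over edges. *)
Lemma sum_ordered_pairs (n : nat) (E : {set {set 'I_n}}) (F : {set 'I_n} -> nat) :
  (forall e, e \in E -> #|e| = 2) ->
  \sum_(i < n) \sum_(j < n | [set i; j] \in E) F [set i; j] = 2 * \sum_(e in E) F e.
Proof.
move=> E2; rewrite pair_big_dep /=.
rewrite (partition_big (fun p => [set p.1; p.2]) (mem E)) //= big_distrr /=.
apply: eq_bigr => e eE.
have /eqP/cards2P[a [b [ab Ee]]] := E2 e eE.
rewrite (eq_bigr (fun=> F e)); last by move=> p /andP[_ /eqP ->].
rewrite sum_nat_const; congr (_ * _).
have -> : 2 = #|[set (a, b); (b, a)]| by rewrite cards2 xpair_eqE (negbTE ab).
apply: eq_card => -[x y]; rewrite !inE !xpair_eqE /=.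
apply/andP/orP => [[_ /eqP E1]|].
  have xe : x \in [set a; b] by rewrite -Ee -E1 !inE eqxx.
  have ye : y \in [set a; b] by rewrite -Ee -E1 !inE eqxx orbT.
  have := E2 e eE; rewrite -E1 cards2.
  case/set2P: xe => ->; case/set2P: ye => ->; rewrite ?eqxx //; by [left|right].
by case=> /andP[/eqP-> /eqP->]; rewrite ?[[set b; a]]setUC -Ee eqxx.
Qed.

Lemma set2_cut (n : nat) (i j : 'I_n) (U : {set 'I_n}) : i != j ->
  (#|[set i; j] :&: U| == 1) = ((i \in U) != (j \in U)).
Proof.
move=> ij; rewrite setIUl.
have h x : [set x] :&: U = if x \in U then [set x] else set0.
  by apply/setP=> y; case: ifP => h; rewrite !inE; case: eqP => // ->.
rewrite !h; case: (i \in U); case: (j \in U) => /=.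
- by rewrite cards2 ij.
- by rewrite setU0 cards1.
- by rewrite set0U cards1.
- by rewrite setU0 cards0.
Qed.

Lemma cut_sizeE (G : graph) (U : {set 'I_(graph_order G)}) :
  cut_size U = \sum_(e in edges G) (#|e :&: U| == 1).
Proof.
rewrite /cut_size -sum1_card big_mkcond [RHS]big_mkcond /=.
by apply: eq_bigr => e _; rewrite !inE; case: (e \in edges G); case: eqP.
Qed.

Lemma sum_adjacent_cut (G : graph) (U : {set 'I_(graph_order G)}) :
  \sum_(i < graph_order G) \sum_(j < graph_order G | [set i; j] \in edges G)
     ((i \in U) != (j \in U) : nat) = 2 * cut_size U.
Proof.
rewrite cut_sizeE -(sum_ordered_pairs _ (@edges_card2 G)).
apply: eq_bigr => i _; apply: eq_bigr => j /edges_card2 ij.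
by rewrite set2_cut //; move: ij; rewrite cards2; case: eqP.
Qed.

Lemma sum_adjacent1 (G : graph) :
  \sum_(i < graph_order G) \sum_(j < graph_order G | [set i; j] \in edges G) 1
    = 2 * #|edges G|.
Proof. by rewrite -sum1_card -(sum_ordered_pairs (fun=> 1) (@edges_card2 G)). Qed.

Lemma cut_size_le_opt (G : graph) (U : {set 'I_(graph_order G)}) : cut_size U <= maxcut_opt G.
Proof. exact: (leq_bigmax (F := fun U : {set 'I_(graph_order G)} => cut_size U)). Qed.

(* Averaging: an edge {a, b} is cut by exactly one of U and U xor {a}. *)
Lemma card_edges_le_opt (G : graph) : #|edges G| <= 2 * maxcut_opt G.
Proof.
set n := graph_order G.
have half (e : {set 'I_n}) : e \in edges G ->
    2 * \sum_(U : {set 'I_n}) (#|e :&: U| == 1) = #|{: {set 'I_n}}|.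
  move=> /edges_card2 /eqP /cards2P[a [b [ab ->]]].
  pose flip (U : {set 'I_n}) := if a \in U then U :\ a else a |: U.
  have flipK : involutive flip.
    move=> U; rewrite /flip; case: (boolP (a \in U)) => aU.
      by rewrite !inE eqxx /= setD1K.
    by rewrite !inE eqxx /= setU1K.
  rewrite mul2n -addnn [X in X + _](reindex_inj (inv_inj flipK)) /= -big_split /=.
  rewrite -sum1_card; apply: eq_bigr => U _.
  rewrite !set2_cut // /flip; case: (boolP (a \in U)) => aU; rewrite !inE eqxx /= [b == a]eq_sym.
    by rewrite (negbTE ab) /=; case: (b \in U).
  by rewrite (negbTE ab) /=; case: (b \in U).
have pos : 0 < #|{: {set 'I_n}}| by apply/card_gt0P; exists set0.
rewrite -(leq_pmul2l pos).
have -> : #|{: {set 'I_n}}| * #|edges G| = 2 * \sum_(U : {set 'I_n}) cut_size U.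
  rewrite (eq_bigr _ (fun U _ => cut_sizeE U)) exchange_big /= big_distrr /=.
  by rewrite (eq_bigr _ half) sum_nat_const mulnC.
rewrite mulnCA leq_mul2l /=.
have -> : #|{: {set 'I_n}}| * maxcut_opt G = \sum_(U : {set 'I_n}) maxcut_opt G.
  by rewrite sum_nat_const.
by apply: leq_sum => U _; apply: cut_size_le_opt.
Qed.

(** * Multiway instances given by lists of keys and links *)

Definition terminal_keys : seq key := [:: (0, 0, 0); (1, 0, 0); (2, 0, 0)].

(* Arcs decrease the kind of the key, so no edge occurs in both directions. *)
Record network : Type := Network {
  inner : seq key;
  arcs : seq link;
  keys_uniq : uniq (terminal_keys ++ inner);
  arcs_keys : forall a, a \in arcs ->
    (a.1.1 \in terminal_keys ++ inner) && (a.1.2 \in terminal_keys ++ inner);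
  arcs_decr : forall a, a \in arcs -> a.1.2.1.1 < a.1.1.1.1;
  arcs_uniq : uniq [seq a.1 | a <- arcs]
}.

Definition nkeys (N : network) : seq key := terminal_keys ++ inner N.

Definition nvertex (N : network) : finType := 'I_(size (inner N)).+3.

(** Vertices are positions in the list of keys, terminals first. A key outside the list is sent to
    the default vertex 0. *)
Definition key_pos (N : network) (k : key) : nvertex N := inord (index k (nkeys N)).

Definition pos_key (N : network) (v : nvertex N) : key := nth (0, 0, 0) (nkeys N) v.

Lemma pos_keyK N : cancel (@pos_key N) (key_pos N).
Proof.
move=> v; rewrite /key_pos /pos_key index_uniq; first exact: inord_val.
  exact: ltn_ord.
exact: keys_uniq.
Qed.

Lemma key_posK N : {in nkeys N, cancel (key_pos N) (@pos_key N)}.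
Proof.
move=> k hk; rewrite /pos_key /key_pos inordK ?nth_index //.
by move: hk; rewrite -index_mem.
Qed.

Definition ends (N : network) (a : link) : {set nvertex N} :=
  [set key_pos N a.1.1; key_pos N a.1.2].

Definition joins (a : link) (k l : key) : bool :=
  ((k == a.1.1) && (l == a.1.2)) || ((k == a.1.2) && (l == a.1.1)).

Lemma set2_eq (T : finType) (p q u v : T) : p != q ->
  ([set p; q] == [set u; v]) = ((u == p) && (v == q)) || ((u == q) && (v == p)).
Proof.
move=> pq; apply/eqP/idP => [E|]; last first.
  by case/orP=> /andP[/eqP-> /eqP->] //; rewrite setUC.
have : p \in [set u; v] by rewrite -E !inE eqxx.
have : q \in [set u; v] by rewrite -E !inE eqxx orbT.
move=> /set2P[] Eq /set2P[] Ep; subst; rewrite ?eqxx ?orbT // in pq *.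
Qed.

Lemma key_pos_eq N k (v : nvertex N) : k \in nkeys N ->
  (v == key_pos N k) = (pos_key v == k).
Proof.
move=> hk; apply/eqP/eqP => [->|<-]; first exact: key_posK.
by rewrite pos_keyK.
Qed.

Lemma arc_ends_neq N a : a \in arcs N -> key_pos N a.1.1 != key_pos N a.1.2.
Proof.
move=> ha; have /andP[h1 h2] := arcs_keys ha.
rewrite key_pos_eq // key_posK //; apply/eqP => E.
by have := arcs_decr ha; rewrite E ltnn.
Qed.

Lemma ends_joins N a (u v : nvertex N) : a \in arcs N ->
  (ends N a == [set u; v]) = joins a (pos_key u) (pos_key v).
Proof.
move=> ha; have /andP[h1 h2] := arcs_keys ha.
by rewrite /ends set2_eq ?arc_ends_neq // !key_pos_eq.
Qed.

(** Equal end sets mean equal or reversed key pairs. Reversal is excluded because arcs decrease the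
    kind, and equal pairs force equal arcs by [arcs_uniq]. *)
Lemma ends_inj N : {in arcs N &, injective (ends N)}.
Proof.
move=> a b ha hb /eqP; have /andP[h1 h2] := arcs_keys hb.
rewrite ends_joins // !key_posK // /joins => /orP[]; last first.
  case/andP=> /eqP E1 /eqP E2.
  have := arcs_decr hb; rewrite E1 E2 => /(ltn_trans (arcs_decr ha)).
  by rewrite ltnn.
case/andP=> /eqP E1 /eqP E2.
have E : a.1 = b.1 by case: (a) (b) E1 E2 => [[? ?] ?] [[? ?] ?] /= -> ->.
have i1 : index a (arcs N) < size [seq a.1 | a <- arcs N] by rewrite size_map index_mem.
have i2 : index b (arcs N) < size [seq a.1 | a <- arcs N] by rewrite size_map index_mem.
have := nth_uniq (0, 0, 0, (0, 0, 0)) i1 i2 (arcs_uniq N).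
rewrite !(nth_map a) ?index_mem // !nth_index // E eqxx => /esym/eqP Ei.
by rewrite -(nth_index a ha) Ei nth_index.
Qed.

Lemma network_card2 N (e : {set nvertex N}) :
  e \in [set e in [seq ends N a | a <- arcs N]] -> #|e| = 2.
Proof. by rewrite inE => /mapP[a /arc_ends_neq ha ->]; rewrite cards2 ha. Qed.

Definition network_graph (N : network) : graph := Graph (@network_card2 N).

Definition network_weight (N : network) (e : {set nvertex N}) : rat :=
  (head 0 [seq a.2 | a <- arcs N & ends N a == e])%:R%R.

Lemma network_weight_ge0 N (e : {set nvertex N}) :
  e \in edges (network_graph N) -> (0 <= network_weight e)%R.
Proof. by rewrite /network_weight ler0n. Qed.

Definition network_terminal (N : network) (i : 'I_3) : nvertex N := inord i.

Lemma network_terminalE N i : network_terminal N i = i :> nat.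
Proof. by rewrite inordK // (leq_trans (ltn_ord i)). Qed.

Lemma network_terminal_inj N : injective (@network_terminal N).
Proof.
by move=> i j /(congr1 val); rewrite /= !network_terminalE => /val_inj.
Qed.

Definition network_instance (N : network) : mp_instance :=
  @MPInstance (network_graph N) (@network_weight N) (@network_weight_ge0 N) 3 isT
    (@network_terminal N) (@network_terminal_inj N).

Lemma weight_ends N a : a \in arcs N -> network_weight (ends N a) = a.2%:R%R.
Proof.
move=> ha; rewrite /network_weight.
suff -> : [seq b <- arcs N | ends N b == ends N a] = [:: a] by [].
have ua : uniq (arcs N) by apply: map_uniq (arcs_uniq N).
rewrite -[RHS](filter_pred1_uniq ua ha).
apply: eq_in_filter => b hb /=; apply/eqP/eqP => [|->//].
exact: ends_inj.
Qed.

Definition arc_cost (lab : key -> nat) (a : link) : nat :=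
  a.2 * (1 + (lab a.1.1 != lab a.1.2)).

Local Open Scope ring_scope.

(** Exchanging the sums over parts and arcs, an arc is paid once for each part it meets: once if its
    ends share a label, twice otherwise. *)
Lemma network_cost (N : network) (S : mp_solution (network_instance N))
    (lab : key -> nat) :
  (forall k, (lab k < 3)%N) ->
  (forall k i, k \in nkeys N -> (key_pos N k \in S i) = (lab k == i :> nat)) ->
  mp_cost S = (\sum_(a <- arcs N) arc_cost lab a)%:R.
Proof.
move=> lab3 hlab; rewrite /mp_cost /coverage.
rewrite (eq_bigr (fun i => \sum_(a <- arcs N) (a.2 * (ends N a :&: S i != set0))%:R)).
  rewrite exchange_big /= natr_sum big_seq_cond [RHS]big_seq_cond.
  apply: eq_bigr => a /andP[ha _]; have /andP[h1 h2] := arcs_keys ha.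
  rewrite -natr_sum; congr (_%:R); rewrite -big_distrr /arc_cost; congr (_ * _)%N.
  have h i : (ends N a :&: S i != set0) = (lab a.1.1 == i) || (lab a.1.2 == i).
    rewrite -!hlab //; apply/set0Pn/orP => [[v]|].
      by rewrite !inE => /andP[/orP[]/eqP-> ->]; [left|right].
    by case=> h; [exists (key_pos N a.1.1)|exists (key_pos N a.1.2)]; rewrite !inE eqxx ?orbT.
  rewrite (eq_bigr _ (fun i _ => congr1 nat_of_bool (h i))).
  rewrite !big_ord_recl big_ord0 /= /bump /=.
  by move: (lab3 a.1.1) (lab3 a.1.2); case: (lab a.1.1) => [|[|[|]]] //; case: (lab a.1.2) => [|[|[|]]].
move=> i _.
rewrite big_mkcondr /=.
rewrite (eq_bigl (mem [seq ends N a | a <- arcs N])); last by move=> e; rewrite inE.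
(* Distinct arcs have distinct end sets, so the sum over the edge set is a sum over the list of
   arcs. *)
rewrite -big_uniq /=; last first.
  by rewrite map_inj_in_uniq; [exact: map_uniq (arcs_uniq N)|exact: ends_inj].
rewrite big_map big_seq [RHS]big_seq; apply: eq_bigr => a ha.
by rewrite weight_ends //; case: ifP => _; rewrite ?muln1 ?muln0.
Qed.

Local Close Scope ring_scope.

Lemma map_pos_key N : [seq pos_key v | v <- enum (nvertex N)] = nkeys N.
Proof.
apply: (@eq_from_nth _ (0, 0, 0)); first by rewrite size_map -cardE card_ord.
move=> i; rewrite size_map -cardE card_ord => hi.
rewrite (nth_map ord0) -?cardE ?card_ord // /pos_key.
by rewrite nth_enum_ord.
Qed.

(** The encoding is expressed through lists of keys and arcs alone, without finite types, which is
    the form that a program on trees can produce. *)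
Lemma enc_network (N : network) : enc_mp_instance (network_instance N) =
  Node (enc_seq [seq enc_seq [seq head Leaf [seq enc_weight a.2%:R%R | a <- arcs N & joins a k l]
                             | l <- nkeys N] | k <- nkeys N])
       (enc_seq [:: enc_unary 0; enc_unary 1; enc_unary 2]).
Proof.
rewrite /enc_mp_instance; congr Node; last first.
  by rewrite !enum_ordSl /= enum_ord0 /= !network_terminalE.
rewrite /enc_matrix -map_pos_key -map_comp; congr enc_seq.
apply: eq_map => u /=; congr enc_seq; rewrite -map_comp.
apply: eq_map => v /=.
rewrite inE /network_weight.
have E : [seq a <- arcs N | ends N a == [set u; v]]
    = [seq a <- arcs N | joins a (pos_key u) (pos_key v)].
  by apply: eq_in_filter => a ha; rewrite ends_joins.
rewrite E.
have -> : ([set u; v] \in [seq ends N a | a <- arcs N]) =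
    (has (fun a => ends N a == [set u; v]) (arcs N)).
  apply/mapP/hasP => [[a ha ->]|[a ha /eqP]]; exists a => //.
rewrite has_filter E.
by case: [seq a <- arcs N | _].
Qed.

(** * The gadget *)

Definition gadget_keys (i j : nat) : seq key :=
  [:: (4, i, j); (5, i, j); (6, i, j); (7, i, j)].

(** Kinds 4, 5, 6, 7 are the inner vertices p, q, r, s, and kinds 0, 1, 2 the terminals. *)
Definition gadget (i j : nat) : seq link :=
  [:: ((4, i, j), (0, 0, 0), 2); ((4, i, j), (2, 0, 0), 2); ((4, i, j), (3, i, 0), 1);
      ((5, i, j), (1, 0, 0), 2); ((5, i, j), (2, 0, 0), 2); ((5, i, j), (3, j, 0), 1);
      ((5, i, j), (4, i, j), 1);
      ((6, i, j), (0, 0, 0), 2); ((6, i, j), (3, i, 0), 2);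
      ((7, i, j), (1, 0, 0), 2); ((7, i, j), (3, i, 0), 2)].

Definition gadget_cost (lab : key -> nat) (i j : nat) : nat :=
  \sum_(a <- gadget i j) arc_cost lab a.

(* Minimum over the labels of the inner vertices of the weight cut in the gadget
   of (i, j), when i and j are labelled a and b. *)
Definition gadget_cut (a b : nat) : nat :=
  match a, b with
  | 0, 1 | 0, 2 | 1, 2 => 7
  | 2, 0 | 2, 1 => 9
  | _, _ => 8
  end.

(** This has the exact shape of the unfolded sum over [gadget], final 0 included, so that
    [gadget_costE] holds by computation. *)
Definition gadget_weight (a b p q r s : nat) : nat :=
  2 * (1 + (p != 0)) + (2 * (1 + (p != 2)) + (1 * (1 + (p != a)) +
  (2 * (1 + (q != 1)) + (2 * (1 + (q != 2)) + (1 * (1 + (q != b)) + (1 * (1 + (q != p)) +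
  (2 * (1 + (r != 0)) + (2 * (1 + (r != a)) +
  (2 * (1 + (s != 1)) + (2 * (1 + (s != a)) + 0)))))))))).

Lemma gadget_costE lab i j :
  lab (0, 0, 0) = 0 -> lab (1, 0, 0) = 1 -> lab (2, 0, 0) = 2 ->
  gadget_cost lab i j = gadget_weight (lab (3, i, 0)) (lab (3, j, 0))
    (lab (4, i, j)) (lab (5, i, j)) (lab (6, i, j)) (lab (7, i, j)).
Proof. by move=> l0 l1 l2; rewrite /gadget_cost /gadget unlock /= /arc_cost /= l0 l1 l2. Qed.

(** The total weight of a gadget is 19, paid even when nothing is cut. The rest is an exhaustive
    check of the 3^6 labellings. *)
Lemma gadget_weight_ge a b p q r s : a < 3 -> b < 3 -> p < 3 -> q < 3 -> r < 3 -> s < 3 ->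
  19 + gadget_cut a b <= gadget_weight a b p q r s.
Proof.
have : all (fun a => all (fun b => all (fun p => all (fun q => all (fun r => all (fun s =>
  19 + gadget_cut a b <= gadget_weight a b p q r s)
  (iota 0 3)) (iota 0 3)) (iota 0 3)) (iota 0 3)) (iota 0 3)) (iota 0 3).
  by vm_compute.
have mem3 x : (x \in iota 0 3) = (x < 3) by rewrite mem_iota.
move=> h ha hb hp hq hr hs.
move/allP/(_ a): h; rewrite mem3 => /(_ ha)/allP/(_ b); rewrite mem3 => /(_ hb).
move=> /allP/(_ p); rewrite mem3 => /(_ hp)/allP/(_ q); rewrite mem3 => /(_ hq).
move=> /allP/(_ r); rewrite mem3 => /(_ hr)/allP/(_ s); rewrite mem3 => /(_ hs).
by [].
Qed.

(** Here 54 = 2 * (19 + 8): the entries of [gadget_cut] at (a, b) and (b, a) add up to 16, except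
    for the labels 0 and 1, where they give 15. Label 2 on an input vertex thus never saves
    anything. *)
Lemma gadget_pair_ge lab i j : (forall k, lab k < 3) ->
  lab (0, 0, 0) = 0 -> lab (1, 0, 0) = 1 -> lab (2, 0, 0) = 2 ->
  54 <= gadget_cost lab i j + gadget_cost lab j i +
        ((lab (3, i, 0) == 0) != (lab (3, j, 0) == 0)).
Proof.
move=> lab3 l0 l1 l2; rewrite !gadget_costE //.
set a := lab (3, i, 0); set b := lab (3, j, 0).
have h1 := @gadget_weight_ge a b _ _ _ _ (lab3 _) (lab3 _)
  (lab3 (4, i, j)) (lab3 (5, i, j)) (lab3 (6, i, j)) (lab3 (7, i, j)).
have h2 := @gadget_weight_ge b a _ _ _ _ (lab3 _) (lab3 _)
  (lab3 (4, j, i)) (lab3 (5, j, i)) (lab3 (6, j, i)) (lab3 (7, j, i)).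
have h3 : 54 <= 19 + gadget_cut a b + (19 + gadget_cut b a) + ((a == 0) != (b == 0)).
  rewrite /a /b; move: (lab3 (3, i, 0)) (lab3 (3, j, 0)).
  by case: (lab (3, i, 0)) => [|[|[|]]] //; case: (lab (3, j, 0)) => [|[|[|]]].
by lia.
Qed.

(** Input vertices in the cut get label 0, the others 1, and the inner labels are optimal for these:
    r and s copy i, p takes 0 or 2 according to i, and q takes 2 or 1 according to j. *)
Definition cut_label (inU : nat -> bool) (k : key) : nat :=
  let: (l, i, j) := k in
  let v x := if inU x then 0 else 1 in
  match l with
  | 0 | 1 | 2 => l
  | 3 => v i
  | 4 => if inU i then 0 else 2
  | 5 => if inU i then if inU j then 2 else 1 else if inU j then 2 else 1
  | _ => v i
  end.

Lemma cut_label_lt3 inU k : cut_label inU k < 3.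
Proof.
by case: k => [[[|[|[|[|[|[|l]]]]]] i] j] //=; case: (inU i) => //; case: (inU j).
Qed.

Lemma gadget_pair_eq inU i j :
  gadget_cost (cut_label inU) i j + gadget_cost (cut_label inU) j i + (inU i != inU j) = 54.
Proof. by rewrite !gadget_costE //=; case: (inU i); case: (inU j). Qed.

(** * Assembly of the reduced network *)

Definition inner_keys (n : nat) : seq key :=
  [seq (3, i, 0) | i <- iota 0 n] ++
  flatten [seq flatten [seq gadget_keys i j | j <- iota 0 n] | i <- iota 0 n].

Definition graph_arcs (G : graph) : seq link :=
  flatten [seq flatten [seq if [set i; j] \in edges G then gadget i j else [::]
                       | j <- enum 'I_(graph_order G)] | i <- enum 'I_(graph_order G)].

(** The tag of an element reveals the block it comes from, so blocks of different indices are
    disjoint. Keys and arcs carry their indices i and j, which serve as tags. *)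
Lemma uniq_flatten_map (S : eqType) (T V : eqType) (f : S -> V) (tag : T -> V)
    (g : S -> seq T) (s : seq S) : injective f -> uniq s ->
  (forall x, uniq (g x)) -> (forall x y, y \in g x -> tag y = f x) ->
  uniq (flatten [seq g x | x <- s]).
Proof.
move=> injf + ug tagP; elim: s => //= x s IH /andP[xs us].
rewrite cat_uniq ug IH // andbT /=; apply/hasPn => y /flatten_mapP[z zs yz].
apply/negP => yx; move: xs; rewrite (injf x z) ?zs //.
by rewrite -(tagP _ _ yx) (tagP _ _ yz).
Qed.

Lemma vertex_key_mem n i : i < n -> (3, i, 0) \in terminal_keys ++ inner_keys n.
Proof.
move=> hi; rewrite mem_cat mem_cat (map_f (fun i => (3, i, 0))) ?orbT //.
by rewrite mem_iota.
Qed.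

Lemma gadget_key_mem n k i j : i < n -> j < n -> k \in gadget_keys i j ->
  k \in terminal_keys ++ inner_keys n.
Proof.
move=> hi hj hk; rewrite mem_cat mem_cat; apply/orP; right; apply/orP; right.
apply/flatten_mapP; exists i; first by rewrite mem_iota.
by apply/flatten_mapP; exists j => //; rewrite mem_iota.
Qed.

Lemma keys_uniq_graph n : uniq (terminal_keys ++ inner_keys n).
Proof.
have mem_gk i y : y \in flatten [seq gadget_keys i j | j <- iota 0 n] -> y.1.2 = i /\ 3 < y.1.1.
  by move=> /flatten_mapP[j _]; rewrite !inE => /or4P[] /eqP ->.
rewrite cat_uniq; apply/and3P; split=> //; last first.
  rewrite cat_uniq; apply/and3P; split.
  - by rewrite map_inj_uniq ?iota_uniq // => i j [].
  - apply/hasPn => y /flatten_mapP[i _ /mem_gk[_ hy]].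
    by apply/mapP => -[i' _ E]; move: hy; rewrite E.
  - apply: (@uniq_flatten_map _ _ _ id (fun y : key => y.1.2)); rewrite ?iota_uniq //.
      move=> i; apply: (@uniq_flatten_map _ _ _ id (fun y : key => y.2)); rewrite ?iota_uniq //.
      by move=> j y; rewrite !inE => /or4P[] /eqP ->.
    by move=> i y /mem_gk[].
apply/hasPn => y; rewrite mem_cat => /orP[/mapP[i _ ->]|]; first by [].
by move=> /flatten_mapP[i _ /mem_gk[_]]; case: y => [[[|[|[|l]]] a] b].
Qed.

Lemma graph_arcsP (G : graph) a : a \in graph_arcs G ->
  exists i j : 'I_(graph_order G), a \in gadget i j.
Proof.
move=> /flatten_mapP[i _ /flatten_mapP[j _]]; case: ifP => // _ ha.
by exists i, j.
Qed.

Lemma graph_arcs_keys (G : graph) a : a \in graph_arcs G ->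
  (a.1.1 \in terminal_keys ++ inner_keys (graph_order G)) &&
  (a.1.2 \in terminal_keys ++ inner_keys (graph_order G)).
Proof.
move=> /graph_arcsP[i [j ha]].
have hg k := @gadget_key_mem _ k i j (ltn_ord i) (ltn_ord j).
have hi := vertex_key_mem (ltn_ord i).
have hj := vertex_key_mem (ltn_ord j).
rewrite !inE in ha.
have mem_t k : k \in terminal_keys -> k \in terminal_keys ++ inner_keys (graph_order G).
  by rewrite mem_cat => ->.
by repeat (case/orP: ha => ha); move/eqP: ha => ->;
  apply/andP; split=> //; first [exact: hi | exact: hj | by apply: hg; rewrite !inE !eqxx ?orbT | by apply: mem_t].
Qed.

Lemma graph_arcs_decr (G : graph) a : a \in graph_arcs G -> a.1.2.1.1 < a.1.1.1.1.
Proof.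
move=> /graph_arcsP[i [j]]; rewrite !inE => ha.
by repeat (case/orP: ha => ha); move/eqP: ha => ->.
Qed.

Lemma graph_arcs_uniq (G : graph) : uniq [seq a.1 | a <- graph_arcs G].
Proof.
rewrite map_flatten -map_comp.
have tagP i j (y : key * key) : y \in [seq a.1 | a <- gadget i j] -> y.1.1.2 = i /\ y.1.2 = j.
  move=> /mapP[a]; rewrite !inE => ha ->.
  by repeat (case/orP: ha => ha); move/eqP: ha => ->.
have memP (i : 'I_(graph_order G)) (y : key * key) :
   y \in [seq a.1 | a <- flatten [seq if [set i; j] \in edges G then gadget i j else [::]
                       | j <- enum 'I_(graph_order G)]] -> y.1.1.2 = i.
  move=> /mapP[a /flatten_mapP[j _]]; case: ifP => // _ ha ->.
  by have [] := tagP i j a.1 (map_f _ ha).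
apply: (@uniq_flatten_map _ _ _ val (fun y : key * key => y.1.1.2)) => //.
- exact: val_inj.
- exact: enum_uniq.
move=> i; rewrite /= map_flatten -map_comp.
apply: (@uniq_flatten_map _ _ _ val (fun y : key * key => y.1.2)) => //.
- exact: val_inj.
- exact: enum_uniq.
- move=> j /=; case: ifP => // _.
  (* Within one gadget the kinds of the two ends already tell the eleven arcs apart. *)
  apply: (@map_uniq _ _ (fun y : key * key => (y.1.1.1, y.2.1.1))).
  by [].
- by move=> j y /=; case: ifP => // _ /tagP[].
Qed.

Definition graph_network (G : graph) : network :=
  @Network (inner_keys (graph_order G)) (graph_arcs G) (keys_uniq_graph _)
    (@graph_arcs_keys G) (@graph_arcs_decr G) (graph_arcs_uniq G).

(** Adjacency is symmetric, so after doubling the sum and swapping the indices in one copy, both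
    gadgets of an edge appear in the same summand. *)
Lemma sum_graph_arcs (G : graph) (lab : key -> nat) :
  2 * \sum_(a <- graph_arcs G) arc_cost lab a =
  \sum_(i < graph_order G) \sum_(j < graph_order G | [set i; j] \in edges G)
    (gadget_cost lab i j + gadget_cost lab j i).
Proof.
have -> : \sum_(a <- graph_arcs G) arc_cost lab a =
  \sum_(i < graph_order G) \sum_(j < graph_order G | [set i; j] \in edges G) gadget_cost lab i j.
  rewrite big_flatten big_map big_enum /=; apply: eq_bigr => i _.
  rewrite big_flatten big_map big_enum /= [RHS]big_mkcond; apply: eq_bigr => j _.
  by case: ifP => // _; rewrite big_nil.
under [RHS]eq_bigr => i _ do rewrite big_split /=.
rewrite big_split /= mul2n -addnn; congr addn.
under eq_bigr => i _ do rewrite big_mkcond /=.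
under [RHS]eq_bigr => i _ do rewrite big_mkcond /=.
by rewrite exchange_big /=; apply: eq_bigr => i _; apply: eq_bigr => j _; rewrite setUC.
Qed.

(** * From solutions to cuts and back *)

Lemma terminal_key_pos N (i : 'I_3) : network_terminal N i = key_pos N (i : nat, 0, 0).
Proof. by case: i => [[|[|[|i]]] hi]. Qed.

Lemma terminal_key_mem N (i : 'I_3) : (i : nat, 0, 0) \in nkeys N.
Proof. by case: i => [[|[|[|i]]] hi]. Qed.

Notation graph_instance G := (network_instance (graph_network G)).

Definition cut_of_solution (G : graph) (S : mp_solution (graph_instance G)) :
    {set 'I_(graph_order G)} :=
  [set v : 'I_(graph_order G) | key_pos (graph_network G) (3, v : nat, 0) \in S ord0].

(** The label of a key is the index of the part containing its vertex: it exists because the parts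
    cover and is unique because they are disjoint. *)
Lemma solution_label (N : network) (S : mp_solution (network_instance N)) :
  mp_feasible S -> exists lab : key -> nat,
   [/\ forall k, lab k < 3,
       forall k i, k \in nkeys N -> (key_pos N k \in S i) = (lab k == i :> nat)
     & forall i : 'I_3, lab (i : nat, 0, 0) = i].
Proof.
move=> [cover disj term].
pose lab k : nat := if [pick i : 'I_3 | key_pos N k \in S i] is Some i then i else 0.
have lab_in k i : (key_pos N k \in S i) = (lab k == i :> nat).
  rewrite /lab; case: pickP => [j hj|none].
    apply/idP/eqP => [hi|/val_inj <- //].
    apply/eqP; apply: contraT => ji.
    by have /pred0P/(_ (key_pos N k)) := disj j i ji; rewrite /= hj hi.
  have : key_pos N k \in \bigcup_(i < 3) S i by rewrite cover inE.
  by case/bigcupP=> j _ hj; have := none j; rewrite hj.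
exists lab; split=> [k|k i _|i]; last 2 first.
- exact: lab_in.
- by apply/eqP; rewrite -lab_in -terminal_key_pos; apply: term.
by rewrite /lab; case: pickP.
Qed.

(** [gadget_pair_ge] is summed over the ordered adjacent pairs, which count every edge twice; hence
    both sides are first doubled. Its correction term is 1 exactly on edges leaving the part of
    terminal 0. *)
Lemma cost_lower_bound (G : graph) (S : mp_solution (graph_instance G)) : mp_feasible S ->
  exists2 c : nat, mp_cost S = c%:R%R &
    54 * #|edges G| <= c + cut_size (cut_of_solution S).
Proof.
move=> /solution_label[lab [lab3 labS labT]].
exists (\sum_(a <- graph_arcs G) arc_cost lab a).
  exact: network_cost labS.
rewrite -(leq_pmul2l (isT : 0 < 2)) mulnDr sum_graph_arcs -sum_adjacent_cut.
rewrite mulnCA -sum_adjacent1 -big_split big_distrr /=; apply: leq_sum => i _.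
rewrite -big_split big_distrr /=; apply: leq_sum => j _.
rewrite muln1 !inE !labS ?vertex_key_mem //.
apply: gadget_pair_ge => //.
- exact: (labT ord0).
- exact: (labT (@Ordinal 3 1 isT)).
- exact: (labT (@Ordinal 3 2 isT)).
Qed.

(** [cut_label] expects a predicate on numbers, whence the list of values of the elements of [U]. *)
Definition solution_of_cut (G : graph) (U : {set 'I_(graph_order G)}) :
    mp_solution (graph_instance G) :=
  fun i => [set v | cut_label (fun x => x \in [seq val u | u in U]) (pos_key v) == i].

Lemma cost_upper_bound (G : graph) (U : {set 'I_(graph_order G)}) :
  mp_feasible (solution_of_cut U) /\
  exists2 c : nat, mp_cost (solution_of_cut U) = c%:R%R &
    c + cut_size U = 54 * #|edges G|.
Proof.
set inU := fun x : nat => x \in [seq val u | u in U].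
split.
  split.
  - apply/setP=> v; rewrite !inE; apply/bigcupP.
    by exists (Ordinal (cut_label_lt3 inU (pos_key v))); rewrite ?inE.
  - move=> i j ij; rewrite -setI_eq0; apply/eqP/setP => v; rewrite !inE.
    apply/negP => /andP[/eqP E1 /eqP E2]; case/eqP: ij.
    by apply: val_inj; rewrite /= -E1 -E2.
  - move=> i; rewrite inE /= terminal_key_pos key_posK ?terminal_key_mem //.
    by case: i => [[|[|[|i]]] hi].
exists (\sum_(a <- graph_arcs G) arc_cost (cut_label inU) a).
  apply: network_cost => [k|k i hk]; first exact: cut_label_lt3.
  by rewrite inE key_posK.
apply/eqP; rewrite -(eqn_pmul2l (isT : 0 < 2)) mulnDr sum_graph_arcs -sum_adjacent_cut.
rewrite mulnCA -sum_adjacent1 -big_split big_distrr /=; apply/eqP; apply: eq_bigr => i _.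
rewrite -big_split big_distrr /=; apply: eq_bigr => j _.
have inUE (x : 'I_(graph_order G)) : inU x = (x \in U).
  by rewrite /inU mem_map ?mem_enum //; exact: val_inj.
by rewrite muln1 -!inUE gadget_pair_eq.
Qed.

Lemma cut_of_solution_approx (R : realType) (alpha : R) (G : graph)
    (S : mp_solution (graph_instance G)) (c : rat) :
  (1 <= alpha)%R -> mp_feasible S -> mp_optimum (graph_instance G) c ->
  (ratr (mp_cost S) <= alpha * ratr c)%R ->
  ((164%:R - 163%:R * alpha) * (maxcut_opt G)%:R <= (cut_size (cut_of_solution S))%:R :> R)%R.
Proof.
move=> alpha1 feas [_ opt] le.
have [cS ES hS] := cost_lower_bound feas.
have [U EU] : exists U : {set 'I_(graph_order G)}, maxcut_opt G = cut_size U.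
  have pos : 0 < #|{: {set 'I_(graph_order G)}}| by apply/card_gt0P; exists set0.
  by have [U E] := @bigop.eq_bigmax _ (fun U : {set 'I_(graph_order G)} => cut_size U) pos; exists U.
have [feasU [cU EcU hU]] := cost_upper_bound U.
have leU := opt _ feasU.
have hm := card_edges_le_opt G.
move: le leU; rewrite ES EcU ratr_nat EU -(ler_rat R) ratr_nat => le leU.
rewrite EU in hm.
move: hS hU hm; rewrite -(ler_nat R) natrM natrD => hS.
move=> /(congr1 (fun n => n%:R : R)%R); rewrite natrM natrD => hU.
rewrite -(ler_nat R) natrM => hm.
have h0 : (0 <= (cut_size U)%:R :> R)%R by rewrite ler0n.
move: hS hU hm h0 le leU.
move: (ratr c : R) (cS%:R : R)%R (cU%:R : R)%R (#|edges G|%:R : R)%R (cut_size U)%:R%R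
  (cut_size (cut_of_solution S))%:R%R => c' cs cu m u s.
move=> hS hU hm h0 le leU.
(* With [u] the maximum cut, this gives [s >= 54 m - alpha (54 m - u)]. Then [m <= 2 u] times
   [alpha - 1] gives [(108 - 107 alpha) u], which exceeds the target by [56 (alpha - 1) u >= 0]. *)
have : (alpha * c' <= alpha * cu)%R by rewrite ler_wpM2l //; lra.
nra.
Qed.

(** * The reduction as a program *)

Lemma tflatmap_enc (T U : Type) (eT : T -> tree) (eU : U -> tree) F c (s : seq T)
    (g : T -> seq U) :
  (forall x, F (Node (eT x) c) = enc_seq (map eU (g x))) ->
  tflatmap F c (enc_seq (map eT s)) = enc_seq (map eU (flatten (map g s))).
Proof.
move=> h; apply: dec_ext; rewrite dec_tflatmap !enc_seqK map_flatten -!map_comp.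
by congr flatten; apply: eq_map => x /=; rewrite h enc_seqK.
Qed.

Lemma tmap_enc (T : Type) (eT : T -> tree) F c (s : seq T) :
  tmap F c (enc_seq (map eT s)) = enc_seq [seq F (Node (eT x) c) | x <- s].
Proof. by apply: dec_ext; rewrite dec_tmap !enc_seqK -map_comp. Qed.

Lemma tcat_enc s1 s2 : tcat (enc_seq s1) (enc_seq s2) = enc_seq (s1 ++ s2).
Proof. by apply: dec_ext; rewrite dec_tcat !enc_seqK. Qed.

Lemma thd_enc s : thd (enc_seq s) = head Leaf s.
Proof. by case: s. Qed.

Lemma tnth_enc i s : thd (tdrop (enc_unary i) (enc_seq s)) = nth Leaf s i.
Proof.
have -> : tdrop (enc_unary i) (enc_seq s) = enc_seq (drop i s).
  by apply: dec_ext; rewrite dec_tdrop !enc_seqK size_nseq.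
by rewrite thd_enc -nth0 nth_drop addn0.
Qed.

Lemma tindices_enc s : tindices (enc_seq s) = enc_seq (map enc_unary (iota 0 (size s))).
Proof. by apply: dec_ext; rewrite dec_tindices !enc_seqK. Qed.

(** The adjacency matrix has one row per vertex, so the indices of its rows enumerate the
    vertices. *)
Lemma tindices_graph (G : graph) : tindices (enc_graph G) =
  enc_seq [seq enc_unary (val i) | i <- enum 'I_(graph_order G)].
Proof.
rewrite tindices_enc size_map size_enum_ord -val_enum_ord -map_comp.
by congr enc_seq; apply: eq_map.
Qed.

Definition enc_arc (a : link) : tree :=
  Node (enc_key a.1.1) (Node (enc_key a.1.2) (enc_weight a.2%:R%R)).

Definition tkey (l : nat) (i j : tree) : tree := Node (enc_unary l) (Node i j).

Definition tarc (k l : tree) (w : nat) : tree := Node k (Node l (enc_weight w%:R%R)).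

Definition tgadget (i j : tree) : tree := enc_seq
  [:: tarc (tkey 4 i j) (tkey 0 Leaf Leaf) 2; tarc (tkey 4 i j) (tkey 2 Leaf Leaf) 2;
      tarc (tkey 4 i j) (tkey 3 i Leaf) 1;
      tarc (tkey 5 i j) (tkey 1 Leaf Leaf) 2; tarc (tkey 5 i j) (tkey 2 Leaf Leaf) 2;
      tarc (tkey 5 i j) (tkey 3 j Leaf) 1; tarc (tkey 5 i j) (tkey 4 i j) 1;
      tarc (tkey 6 i j) (tkey 0 Leaf Leaf) 2; tarc (tkey 6 i j) (tkey 3 i Leaf) 2;
      tarc (tkey 7 i j) (tkey 1 Leaf Leaf) 2; tarc (tkey 7 i j) (tkey 3 i Leaf) 2].

(* The nested functions below receive the loop variables, innermost first, in
   front of the encoding of the graph. *)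
Definition tarcs_at (x : tree) : tree :=
  if truthy (thd (tdrop (thd x) (thd (tdrop (thd (ttl x)) (ttl (ttl x))))))
  then tgadget (thd (ttl x)) (thd x) else Leaf.

Definition tarcs_from (x : tree) : tree := tflatmap tarcs_at x (tindices (ttl x)).

Definition tarcs (g : tree) : tree := tflatmap tarcs_from g (tindices g).

Lemma tarcsE (G : graph) : tarcs (enc_graph G) = enc_seq (map enc_arc (graph_arcs G)).
Proof.
rewrite /tarcs tindices_graph /graph_arcs; apply: tflatmap_enc => i.
rewrite /tarcs_from [ttl _]/= tindices_graph; apply: tflatmap_enc => j.
rewrite /tarcs_at [thd _ in X in if X then _ else _]/=.
(* The adjacency test is two lookups: row [i] of the matrix, then its entry [j]. *)
rewrite !tnth_enc (nth_map i) ?size_enum_ord // nth_ord_enum.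
rewrite tnth_enc (nth_map j) ?size_enum_ord // nth_ord_enum.
by case: ifP => h; rewrite /enc_bool /= (fun_if (map enc_arc)); case: ifP h.
Qed.

Definition tgadget_keys (i j : tree) : tree :=
  enc_seq [:: tkey 4 i j; tkey 5 i j; tkey 6 i j; tkey 7 i j].

Definition tkeys_from (x : tree) : tree :=
  tflatmap (fun y => tgadget_keys (thd (ttl y)) (thd y)) x (tindices (ttl x)).

Definition tkeys (g : tree) : tree :=
  tcat (enc_seq (map enc_key terminal_keys))
    (tcat (tmap (fun y => tkey 3 (thd y) Leaf) Leaf (tindices g))
          (tflatmap tkeys_from g (tindices g))).

Lemma tkeysE (G : graph) :
  tkeys (enc_graph G) = enc_seq (map enc_key (nkeys (graph_network G))).
Proof.
have size_g : size [seq enc_seq [seq enc_bool ([set i; j] \in edges G) | j <- enum 'I_(graph_order G)]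
   | i <- enum 'I_(graph_order G)] = graph_order G by rewrite size_map size_enum_ord.
rewrite /tkeys /nkeys map_cat -tcat_enc; congr tcat.
rewrite [inner _]/= /inner_keys map_cat -tcat_enc; congr tcat.
  by rewrite tindices_enc size_g tmap_enc -map_comp.
rewrite {2}/enc_graph tindices_enc size_g; apply: tflatmap_enc => i.
rewrite /tkeys_from [ttl _]/= tindices_enc size_g.
exact: tflatmap_enc.
Qed.

Definition tor (a b : tree) : tree := if truthy a then a else b.
Definition tand (a b : tree) : tree := if truthy a then b else Leaf.

Lemma truthy_or a b : truthy (tor a b) = truthy a || truthy b.
Proof. by rewrite /tor; case: ifP. Qed.

Lemma truthy_and a b : truthy (tand a b) = truthy a && truthy b.
Proof. by rewrite /tand; case: ifP. Qed.

(** The argument holds an arc, then the column key, then the row key; the result is a list of at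
    most one weight, so that [tentry] searches by a flat map and takes the head. *)
Definition tjoin (x : tree) : tree :=
  if truthy (tor
    (tand (tkey_eq (ttl (ttl x)) (thd (thd x))) (tkey_eq (thd (ttl x)) (thd (ttl (thd x)))))
    (tand (tkey_eq (ttl (ttl x)) (thd (ttl (thd x)))) (tkey_eq (thd (ttl x)) (thd (thd x)))))
  then Node (ttl (ttl (thd x))) Leaf else Leaf.

Definition tentry (x : tree) : tree :=
  thd (tflatmap tjoin (Node (thd x) (thd (ttl x))) (ttl (ttl x))).

Definition trow (x : tree) : tree :=
  tmap tentry (Node (thd x) (ttl (ttl x))) (thd (ttl x)).

Definition tmatrix (x : tree) : tree := tmap trow x (thd x).

Lemma tentryE (N : network) k l :
  tentry (Node (enc_key l) (Node (enc_key k) (enc_seq (map enc_arc (arcs N))))) =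
  head Leaf [seq enc_weight a.2%:R%R | a <- arcs N & joins a k l].
Proof.
rewrite /tentry [ttl _]/= -thd_enc; congr thd.
rewrite (@tflatmap_enc _ _ enc_arc id _ _ _ (fun a : link =>
   if joins a k l then [:: enc_weight a.2%:R%R] else [::])).
  rewrite map_id; congr enc_seq; elim: (arcs N) => //= a s ->.
  by case: ifP.
move=> a; rewrite /tjoin /= truthy_or 2!truthy_and !tkey_eqE /joins.
by case: ifP.
Qed.

Lemma tmatrixE (N : network) :
  tmatrix (Node (enc_seq (map enc_key (nkeys N))) (enc_seq (map enc_arc (arcs N)))) =
  enc_seq [seq enc_seq [seq head Leaf [seq enc_weight a.2%:R%R | a <- arcs N & joins a k l]
                       | l <- nkeys N] | k <- nkeys N].
Proof.
move: (nkeys N) => ks; rewrite /tmatrix /= tmap_enc; congr enc_seq; apply: eq_map => k.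
rewrite /trow /= tmap_enc; congr enc_seq; apply: eq_map => l.
exact: tentryE.
Qed.

Definition treduce (g : tree) : tree :=
  Node (tmatrix (Node (tkeys g) (tarcs g)))
       (enc_seq [:: enc_unary 0; enc_unary 1; enc_unary 2]).

Lemma treduceE (G : graph) : treduce (enc_graph G) = enc_mp_instance (graph_instance G).
Proof. by rewrite enc_network /treduce tkeysE tarcsE -tmatrixE. Qed.

(** The first part of the solution is a list of bits whose first three entries belong to the
    terminals; the input vertices come next in order, so the cut is read off after three tails. *)
Definition tdecode (x : tree) : tree :=
  tmap (fun y => thd (tdrop (thd y) (ttl y))) (ttl (ttl (ttl (thd (thd x))))) (tindices (ttl x)).

Lemma vertex_key_pos (G : graph) (v : 'I_(graph_order G)) :
  key_pos (graph_network G) (3, v : nat, 0) = v.+3 :> nat.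
Proof.
have hv : v.+3 < (size (inner (graph_network G))).+3.
  by rewrite /= /inner_keys size_cat size_map size_iota !ltnS ltn_addr.
have -> : (3, v : nat, 0) = pos_key (N := graph_network G) (Ordinal hv).
  rewrite /pos_key /= /inner_keys nth_cat size_map size_iota ltn_ord.
  by rewrite (nth_map 0) ?size_iota // nth_iota.
by rewrite pos_keyK.
Qed.

Lemma tdecodeE (G : graph) (S : mp_solution (graph_instance G)) :
  tdecode (Node (enc_mp_solution S) (enc_graph G)) = enc_set (cut_of_solution S).
Proof.
have ES : thd (enc_mp_solution S) = enc_set (S ord0).
  by rewrite /enc_mp_solution thd_enc /= enum_ordSl.
have ttl3 s : ttl (ttl (ttl (enc_seq s))) = enc_seq (drop 3 s).
  by case: s => [|? [|? [|? s]]] //=; rewrite drop0.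
rewrite /tdecode /= tindices_graph ES /enc_set ttl3 tmap_enc; congr enc_seq.
apply: eq_map => v /=.
rewrite tnth_enc nth_drop add3n inE -vertex_key_pos.
by rewrite (nth_map ord0) ?size_enum_ord // nth_ord_enum.
Qed.

(** * Running time of the reduction *)

Ltac ptime_tac := repeat (ptime_step || apply: ptime_key_eq).

Lemma ptime_gadget f g : ptime f -> ptime g -> ptime (fun x => tgadget (f x) (g x)).
Proof. by move=> pf pg; rewrite /tgadget /tarc /tkey /=; ptime_tac. Qed.

Lemma ptime_arcs : ptime tarcs.
Proof.
have p1 : ptime tarcs_at.
  by rewrite /tarcs_at; ptime_tac; apply: ptime_gadget; ptime_tac.
have p2 : ptime tarcs_from by apply: ptime_flatmap => //; ptime_tac.
by apply: ptime_flatmap => //; ptime_tac.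
Qed.

Lemma ptime_keys : ptime tkeys.
Proof.
have p1 : ptime (fun y => tgadget_keys (thd (ttl y)) (thd y)).
  by rewrite /tgadget_keys /tkey /=; ptime_tac.
have p2 : ptime tkeys_from by apply: ptime_flatmap => //; ptime_tac.
have p3 : ptime (fun y => tkey 3 (thd y) Leaf) by rewrite /tkey; ptime_tac.
by rewrite /tkeys; ptime_tac.
Qed.

Lemma ptime_matrix : ptime tmatrix.
Proof.
have p1 : ptime tjoin by rewrite /tjoin /tor /tand; ptime_tac.
have p2 : ptime tentry by rewrite /tentry; ptime_tac.
have p3 : ptime trow by rewrite /trow; ptime_tac.
by rewrite /tmatrix; ptime_tac.
Qed.

Lemma ptime_reduce : ptime treduce.
Proof.
apply: ptime_node; last exact: ptime_const.
apply: (ptime_comp ptime_matrix); apply: ptime_node; [exact: ptime_keys|exact: ptime_arcs].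
Qed.

Lemma ptime_decode : ptime tdecode.
Proof.
have p1 : ptime (fun y => thd (tdrop (thd y) (ttl y))) by ptime_tac.
by rewrite /tdecode; ptime_tac.
Qed.

Theorem theorem3p2 (R : realType) (alpha : R) (halpha : (1 <= alpha)%R) :
  graph_coverage_mp_approximable alpha ->
  maxcut_approximable (164%:R - 163%:R * alpha)%R.
Proof.
apply: (@polytime_reduction _ _ _ _ _ _ _ _ _ _ _ _ (fun G => graph_instance G)
  (fun G S => cut_of_solution S) ptime_reduce ptime_decode) => [G|G S _|G S [feas [c opt le]]].
- exact: treduceE.
- exact: tdecodeE.
- exact: cut_of_solution_approx opt le.
Qed.
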